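(* The language $\mathtt{KNAPSACK\text{-}GAME}$ can be verified by a 2QCFA (as verifier in an Arthur-Merlin proof system) with perfect-completeness in exponential expected time.
   Context: **The language.** $\mathtt{KNAPSACK\text{-}GAME}$ is the set of strings of the form $$S\;\forall(a_1,b_1)\,\exists(e_1,f_1)\cdots\forall(a_n,b_n)\,\exists(e_n,f_n),$$ where $S$ and each $a_i,b_i,e_i,f_i$ ($1\le i\le n$) are natural numbers given in binary, and for every $x=(x_1,\ldots,x_n)\in\times_{i=1}^n\{a_i,b_i\}$ there exists a $y=(y_1,\ldots,y_n)\in\times_{i=1}^n\{e_i,f_i\}$ such that $S=\sum_{i=1}^n (x_i+y_i)$. **Superoperators.** A superoperator on a finite-dimensional quantum register is a finite list of square matrices (operation elements) $\mathcal{E}=\{E_1,\dots,E_k\}$, $k>0$, with $\sum_{j=1}^k E_j^\dagger E_j=I$. Applied to a state $|v\rangle$, it gives outcome $j$ with probability $p_j=\|E_j|v\rangle\|^2$, and then the new state is $E_j|v\rangle/\sqrt{p_j}$. All entries of superoperators are assumed to be rational numbers. **2QCFA verifier (two-way finite automaton with quantum and classical states).** It has a finite set of classical states, partitioned into communication states and reading states; a finite set of quantum states; an input alphabet $\Sigma$ not containing the left and right end-markers ¢ and \$; a communication alphabet $\Upsilon$; transition functions $\delta_c,\delta_r,\delta_q$; a starting classical state $s_I$ and a starting quantum state $q_I$; and accepting and rejecting classical states $s_{acc},s_{rej}$. The input $w\in\Sigma^*$ is placed on a read-only tape as ¢$w$\$. The verifier $V$ starts in $(s_I,|q_I\rangle)$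 with its head on ¢. In a communication state $s_c$, $V$ writes a symbol on the communication channel, the prover overwrites it with a response $\upsilon\in\Upsilon$, and $V$ moves to the classical state $\delta_c(s_c,\upsilon)$. In a reading state $s_r$ scanning $\sigma$, $V$ applies the superoperator $\delta_q(s_r,\sigma)$ to its quantum register, the measurement outcome $j$ is written on the communication channel to be shared with the prover, and then $\delta_r(s_r,\sigma,j)=(s',d)$ gives the new classical state $s'$ and the head move $d\in\{-1,0,1\}$ (left, stay, right). The head never leaves ¢$w$\$. The input is accepted if $V$ enters $s_{acc}$ and rejected if $V$ enters $s_{rej}$; in either case the computation terminates. Arthur-Merlin proof systems are public-coin: the computation of the verifier is visible to the prover. **Verification.** A language $L\subseteq\Sigma^*$ is verified by $V$ with error bound $\epsilon\in[0,\frac12)$ (with bounded error) if and only if: when $w\in L$, $V$ communicating with an honest prover $P$ accepts $w$ with probability at least $1-\epsilon$; and when $w\notin L$, $V$ rejects $w$ with probability at least $1-\epsilon$ when communicating with any possible prover $P^*$ (including cheating ones). If every member is accepted with probability $1$, then $L$ is verified with perfect-completeness. Running time is measured as a function of the input length. *)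

(* Defs.v *)
From HB Require Import structures.
From mathcomp Require Import all_boot all_order all_algebra.
From mathcomp Require Import all_classical all_reals all_analysis.

Set Implicit Arguments.
Unset Strict Implicit.
Unset Printing Implicit Defensive.

Import Order.TTheory GRing.Theory Num.Theory.
Import numFieldNormedType.Exports.

Local Open Scope ring_scope.

Inductive ksym : Type :=
  | Digit of bool | ForallSym | ExistsSym | LParen | Comma | RParen.

(* The number denoted by a bit string, most significant bit first. A binary
   numeral is any nonempty bit string: superfluous leading zeros are allowed. *)
Definition binval (u : seq bool) : nat :=
  foldl (fun (m : nat) (b : bool) => (m.*2 + b)%N) 0%N u.

Definition pair_string (u v : seq bool) : seq ksym :=
  LParen :: [seq Digit d | d <- u] ++ Comma :: [seq Digit d | d <- v]
    ++ [:: RParen].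

Definition game_string (n : nat) (S : seq bool) (a b e f : 'I_n -> seq bool) :
    seq ksym :=
  [seq Digit d | d <- S] ++
  flatten [seq ForallSym :: pair_string (a i) (b i) ++
               ExistsSym :: pair_string (e i) (f i) | i <- enum 'I_n].

(* Each y may depend on the whole of x. *)
Definition knapsack_game (w : seq ksym) : Prop :=
  exists (n : nat) (S : seq bool) (a b e f : 'I_n -> seq bool),
    [/\ (0 < n)%N,
        S != [::] /\
          (forall i, [/\ a i != [::], b i != [::], e i != [::] & f i != [::]]),
        w = game_string S a b e f
      & forall x : 'I_n -> nat,
          (forall i, x i = binval (a i) \/ x i = binval (b i)) ->
          exists y : 'I_n -> nat,
            (forall i, y i = binval (e i) \/ y i = binval (f i)) /\
            binval S = (\sum_(i < n) (x i + y i))%N].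

(* The entries being rational, the conjugate transpose is the transpose. *)
Definition superoperator (m : nat) (E : seq 'M[rat]_m) : Prop :=
  (0 < size E)%N /\ \sum_(A <- E) A^T *m A = 1%:M.

Inductive tape_symbol (Sigma : Type) : Type :=
  | LeftEnd | Sym of Sigma | RightEnd.
Arguments LeftEnd {Sigma}.
Arguments RightEnd {Sigma}.

Inductive direction : Type := MoveLeft | Stay | MoveRight.

Definition move_head (d : direction) (i : nat) : nat :=
  match d with MoveLeft => i.-1 | Stay => i | MoveRight => i.+1 end.

(* The states outside [is_comm] are the reading states; the transition
   functions are only ever used on states of the relevant kind. A measurement
   outcome [j] is an index (from 0) into the list of operation elements. *)
Record verifier (Sigma : Type) := Verifier {
  state : finType;
  is_comm : pred state;
  qdim : nat;
  upsilon : finType;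
  write : state -> upsilon;
  delta_c : state -> upsilon -> state;
  delta_q : state -> tape_symbol Sigma -> seq 'M[rat]_qdim;
  delta_r : state -> tape_symbol Sigma -> nat -> state * direction;
  s_init : state;
  q_init : 'I_qdim;
  s_acc : state;
  s_rej : state;
  s_acc_neq_rej : s_acc != s_rej;
  delta_q_superoperator : forall s sigma,
    ~~ is_comm s -> superoperator (delta_q s sigma);
  head_left_end : forall s j,
    ~~ is_comm s -> (delta_r s LeftEnd j).2 <> MoveLeft;
  head_right_end : forall s j,
    ~~ is_comm s -> (delta_r s RightEnd j).2 <> MoveRight
}.

Definition tape_at (Sigma : Type) (w : seq Sigma) (i : nat) :
    tape_symbol Sigma :=
  nth RightEnd (LeftEnd :: [seq Sym x | x <- w]) i.

(* What appears on the channel. As the transition functions are deterministic,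
   the input and the list of events determine the complete configuration of the
   verifier (classical state, head position, quantum state). *)
Inductive event (Upsilon : Type) : Type :=
  | Sent of Upsilon | Response of Upsilon | Outcome of nat.
Arguments Outcome {Upsilon}.

Record distribution (R : realType) (T : finType) := Distribution {
  pmf :> T -> R;
  pmf_ge0 : forall x, 0 <= pmf x;
  pmf_sum1 : \sum_x pmf x = 1
}.

(* A prover knows the input and all past events, the most recent one first, and
   may randomize its response. *)
Definition prover (R : realType) (Sigma : Type) (V : verifier Sigma) : Type :=
  seq Sigma -> seq (event (upsilon V)) -> distribution R (upsilon V).

Record config (R : realType) (Sigma : Type) (V : verifier Sigma) := Config {
  cstate : state V;
  chead : nat;
  cquantum : 'cV[R]_(qdim V);
  chistory : seq (event (upsilon V))
}.

(* The squared Euclidean norm; the library norm [`|v|] of a matrix is the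
   maximum norm. *)
Definition sqnorm (R : realType) (m : nat) (v : 'cV[R]_m) : R :=
  \sum_i v i 0 ^+ 2.

Section Computation.
Context {R : realType} {Sigma : Type} {V : verifier Sigma}.
Implicit Types (P : prover R V) (w : seq Sigma) (c : config R V).

Definition init_config : config R V :=
  Config (s_init V) 0 (delta_mx (q_init V) 0) [::].

Definition accepting c : bool := cstate c == s_acc V.
Definition rejecting c : bool := cstate c == s_rej V.
Definition halted c : bool := accepting c || rejecting c.

Definition comm_step P w c : seq (R * config R V) :=
  let s := cstate c in
  let h := Sent (write s) :: chistory c in
  [seq (P w h u,
        Config (delta_c s u) (chead c) (cquantum c) (Response u :: h))
  | u <- enum (upsilon V)].

Definition read_step w c : seq (R * config R V) :=
  let s := cstate c in
  let sigma := tape_at w (chead c) in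
  [seq let v := map_mx ratr (nth 0 (delta_q s sigma) j) *m cquantum c in
       let p := sqnorm v in
       let r := delta_r s sigma j in
       (p, Config r.1 (move_head r.2 (chead c)) ((Num.sqrt p)^-1 *: v)
             (Outcome j :: chistory c))
  | j <- iota 0 (size (delta_q s sigma))].

(* The possible successors with their probabilities; halted configurations are
   made absorbing. *)
Definition step P w c : seq (R * config R V) :=
  if halted c then [:: (1, c)]
  else if is_comm (cstate c) then comm_step P w c
  else read_step w c.

(* The probability that the configuration reached from [c] in [t] steps
   satisfies [Q]. *)
Fixpoint prob_from P w (Q : pred (config R V)) (t : nat) c : R :=
  if t is t'.+1 then \sum_(x <- step P w c) x.1 * prob_from P w Q t' x.2
  else (Q c)%:R.

Definition prob_after P w Q t : R := prob_from P w Q t init_config.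

Definition accept_prob P w : R := limn (prob_after P w accepting).
Definition reject_prob P w : R := limn (prob_after P w rejecting).

(* E[T] for the number T of steps before termination, with values in
   {0, 1, ..., +oo}: the sum of t * Pr[T = t] over t > 0, plus
   +oo * Pr[T = +oo], where +oo * 0 = 0. *)
Definition expected_time P w : \bar R :=
  (\sum_(0 <= t <oo)
     (t.+1%:R * (prob_after P w halted t.+1 - prob_after P w halted t))%:E
   + +oo * (1 - limn (prob_after P w halted))%:E)%E.

End Computation.

Definition verifies (R : realType) (Sigma : Type) (V : verifier Sigma)
    (P : prover R V) (L : seq Sigma -> Prop) (eps : R) : Prop :=
  (forall w, L w -> 1 - eps <= accept_prob P w) /\
  (forall w, ~ L w -> forall P' : prover R V, 1 - eps <= reject_prob P' w).

Definition perfectly_complete (R : realType) (Sigma : Type)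
    (V : verifier Sigma) (P : prover R V) (L : seq Sigma -> Prop) : Prop :=
  forall w, L w -> accept_prob P w = 1.

(* Expected time 2^O(n) on inputs of length n, whatever the prover does. *)
Definition exponential_expected_time (R : realType) (Sigma : Type)
    (V : verifier Sigma) : Prop :=
  exists C k : nat, forall (P : prover R V) (w : seq Sigma),
    (expected_time P w <= ((C * 2 ^ (k * size w))%N%:R)%:E)%E.

(* Main.v *)
Require Import Defs.
From HB Require Import structures.
From mathcomp Require Import all_boot all_order all_algebra.
From mathcomp Require Import all_classical all_reals all_analysis.
From mathcomp Require Import zify ring lra.

(* The verifier repeats rounds. In a round, a first pass over the input picks
   each [x_i] by a coin, a measurement outcome that the prover sees, while the
   register accumulates [S - sum x_i], and a second pass subtracts the [y_i] that
   the prover picks. Every symbol shrinks the register by a constant factor, the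
   remaining outcomes restarting the round, and a further amplitude loses another
   factor 2 at each symbol. Finally the balance is measured, which rejects, and
   then the small amplitude, which accepts. A zero balance is never detected, so
   that a member is never rejected; otherwise, for some [x] the balance is a
   nonzero integer, and the probability of rejecting exceeds that of accepting,
   the coins costing less than what the small amplitude has lost.

   The analysis uses potentials that are quadratic in the unnormalized register
   and do not increase on average, whatever the prover does. *)

Set Implicit Arguments.
Unset Strict Implicit.
Unset Printing Implicit Defensive.

Import Order.TTheory GRing.Theory Num.Theory.
Import numFieldNormedType.Exports.

Local Open Scope ring_scope.

(** * The game played along the input *)

(* The numeral being read is [S] if the index is [None], and component [b] of
   the pair quantified by [t] if it is [Some (t, b)], where [false] stands for
   the universal quantifier and for the first component. *)
Inductive location : Type :=
  | InNumeral of option (bool * bool) & bool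
  | ExpectParen of bool
  | ExpectQuantifier of bool.

Definition location_code (q : location) :
    option (bool * bool) * bool + (bool + bool) :=
  match q with
  | InNumeral k ne => inl (k, ne)
  | ExpectParen t => inr (inl t)
  | ExpectQuantifier t => inr (inr t)
  end.

Definition location_decode (x : option (bool * bool) * bool + (bool + bool)) :=
  match x with
  | inl (k, ne) => InNumeral k ne
  | inr (inl t) => ExpectParen t
  | inr (inr t) => ExpectQuantifier t
  end.

Lemma location_codeK : cancel location_code location_decode.
Proof. by case. Qed.

HB.instance Definition _ := Finite.copy location (can_type location_codeK).

Definition start : location := InNumeral None false.

(** The automaton of well-formed inputs. The last argument of [InNumeral] records whether a digit
    has been read, so that empty numerals are refused. Inputs must end in [ExpectQuantifier false],
    which is reached only after a whole block, so there is at least one block. *)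
Definition next_location (q : location) (x : ksym) : option location :=
  match x, q with
  | Digit _, InNumeral k _ => Some (InNumeral k true)
  | ForallSym, InNumeral None true | ForallSym, ExpectQuantifier false =>
      Some (ExpectParen false)
  | ExistsSym, ExpectQuantifier true => Some (ExpectParen true)
  | LParen, ExpectParen t => Some (InNumeral (Some (t, false)) false)
  | Comma, InNumeral (Some (t, false)) true =>
      Some (InNumeral (Some (t, true)) false)
  | RParen, InNumeral (Some (t, true)) true => Some (ExpectQuantifier (~~ t))
  | _, _ => None
  end.

(** A coin and a bit of the prover are drawn after every symbol, but kept only when drawn just after
    the quantifier [t]. One stored bit suffices, as a choice is consulted only within its own
    pair. *)
Definition choose_after (t : bool) (q : location) (b ch : bool) : bool :=
  if q == ExpectParen t then b else ch.

(* The first pass ([p = false]) computes [S] minus the chosen [x]; the second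
   one subtracts the chosen [y]. *)
Definition coefficient (p : bool) (q : location) (ch : bool) : int :=
  match q with
  | InNumeral None _ => (~~ p)%:R
  | InNumeral (Some (t, b)) _ => - ((t == p) && (b == ch))%:R
  | _ => 0
  end.

Definition current_update (x : ksym) (z : int) : int :=
  if x is Digit b then 2 * z + b%:R else 0.

(** A numeral is complete once a symbol other than a digit follows it; [q], the location before that
    symbol, determines its coefficient. *)
Definition balance_update p q ch (x : ksym) (z1 z2 : int) : int :=
  if x is Digit _ then z2 else z2 + coefficient p q ch * z1.

(* The prover can win the rest of a pass whose remaining input is [s], against
   all the coins [j], from the current numeral [z1] and the balance [z2]. *)
Fixpoint pass_win (K : int -> int -> Prop) p q ch (s : seq ksym) (z1 z2 : int) :
    Prop :=
  if s is x :: s' then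
    if next_location q x is Some q' then
      forall j, exists u,
        pass_win K p q' (choose_after true q' u (choose_after false q' j ch)) s'
          (current_update x z1) (balance_update p q ch x z1 z2)
    else False
  else q = ExpectQuantifier false /\ K z1 z2.

(** The first pass hands its result to a second pass over the whole of [w]. This is why there are
    two passes: every [y] is chosen when all of [x] is known. *)
Definition win (w : seq ksym) (p : bool) :=
  if p then pass_win (fun _ z2 => z2 = 0) true
  else pass_win (pass_win (fun _ z2 => z2 = 0) true start false w) false.

(** * Winning a pass, in terms of the blocks of the input *)

Definition block : Type := (seq bool * seq bool) * (seq bool * seq bool).

Definition block_string (k : block) : seq ksym :=
  ForallSym :: pair_string k.1.1 k.1.2 ++ ExistsSym :: pair_string k.2.1 k.2.2.

Definition block_wf (k : block) : bool :=
  [&& k.1.1 != [::], k.1.2 != [::], k.2.1 != [::] & k.2.2 != [::]].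

Definition block_value (p c : bool) (k : block) : nat :=
  let ab := if p then k.2 else k.1 in binval (if c then ab.2 else ab.1).

Definition blocks_string (l : seq block) : seq ksym :=
  flatten [seq block_string k | k <- l].

Definition total (p : bool) (c : seq bool) (l : seq block) : nat :=
  \sum_(x <- zip c l) block_value p x.1 x.2.

Lemma pass_win_digits K p k ne ch u s z1 z2 :
  pass_win K p (InNumeral k ne) ch ([seq Digit d | d <- u] ++ s) z1 z2 <->
  pass_win K p (InNumeral k (ne || (u != [::]))) ch s
    (foldl (fun z (b : bool) => 2 * z + b%:R) z1 u) z2.
Proof.
elim: u ne z1 => [|b u IH] ne z1; first by rewrite orbF.
rewrite /= orbT; split.
  by move=> /(_ false)[_ /IH].
by move=> h j; exists false; apply/IH.
Qed.

Lemma foldl_binval (u : seq bool) :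
  foldl (fun z (b : bool) => 2 * z + b%:R) (0 : int) u = (binval u)%:Z.
Proof.
suff acc m : foldl (fun z (b : bool) => 2 * z + b%:R) m%:Z u =
    (foldl (fun (m : nat) (b : bool) => (m.*2 + b)%N) m u)%:Z by exact: acc 0%N.
by elim: u m => //= b u IH m; rewrite -IH; congr foldl; case: b => /=; lia.
Qed.

Lemma pass_win_pair K p t ch u v s z :
  u != [::] -> v != [::] ->
  pass_win K p (ExpectParen t) ch (pair_string u v ++ s) 0 z <->
  pass_win K p (ExpectQuantifier (~~ t)) ch s 0
    (z - (t == p)%:R * (binval (if ch then v else u))%:Z).
Proof.
move=> u0 v0; rewrite /pair_string /= -catA /=.
split.
- move=> /(_ false)[?]; rewrite /choose_after /= mul0r ?mul0r ?addr0.
  move=> /pass_win_digits; rewrite u0 /= => /(_ false)[?].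
  rewrite -catA => /pass_win_digits; rewrite v0 /= => /(_ false)[?].
  rewrite /choose_after /= !foldl_binval.
  by congr pass_win; case: (t == p); case: ch => /=; lia.
move=> h j; exists false; rewrite /choose_after /= ?mul0r ?addr0.
apply/pass_win_digits; rewrite u0 /= => ?; exists false.
rewrite -catA; apply/pass_win_digits; rewrite v0 /= => ?; exists false.
rewrite /choose_after /= !foldl_binval.
by move: h; congr pass_win; case: (t == p); case: ch => /=; lia.
Qed.

(** Only one of the two choices enters the balance: the coin in the first pass, the prover's bit in
    the second. [c'] is also the bit left in memory after the block. *)
Lemma pass_win_block K p ch k s z : block_wf k ->
  pass_win K p (ExpectQuantifier false) ch (block_string k ++ s) 0 z <->
  forall c : bool, exists c' : bool,
    pass_win K p (ExpectQuantifier false) c' s 0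
      (z - (block_value p (if p then c' else c) k)%:Z).
Proof.
case: k => [[a b] [e f]] /and4P /= [a0 b0 e0 f0].
rewrite /block_string /= -catA.
split=> h c.
- have [?] := h c; rewrite /choose_after /= mul0r addr0.
  move=> /(pass_win_pair K p _ _ _ _ a0 b0) /= /(_ false)[c'].
  rewrite /choose_after /= mul0r addr0.
  move=> /(pass_win_pair K p _ _ _ _ e0 f0) /= h'; exists c'.
  by move: h' {h}; congr pass_win; rewrite /block_value; case: p; case: c;
    case: c' => /=; lia.
have [c' h'] := h c; exists c; rewrite /choose_after /= mul0r addr0.
apply/(pass_win_pair K p _ _ _ _ a0 b0) => /= ?; exists c'.
rewrite /choose_after /= mul0r addr0.
apply/(pass_win_pair K p _ _ _ _ e0 f0) => /=.
by move: h' {h}; congr pass_win; rewrite /block_value; case: p; case: c;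
  case: c' => /=; lia.
Qed.

Lemma total_cons p c cs k l :
  total p (c :: cs) (k :: l) = (block_value p c k + total p cs l)%N.
Proof. by rewrite /total /= big_cons. Qed.

(** The prover's bits do not affect the balance in the first pass, so the alternation collapses to a
    universal quantifier over the coins; dually for [pass_win_exists]. As [K] is arbitrary, the
    second pass can be plugged in. *)
Lemma pass_win_forall K ch l z : all block_wf l ->
  pass_win K false (ExpectQuantifier false) ch (blocks_string l) 0 z <->
  forall c, size c = size l -> K 0 (z - (total false c l)%:Z).
Proof.
elim: l ch z => [|k l IH] ch z /=.
  move=> _; split=> [[_ h] [|//] _|h]; rewrite ?/total ?big_nil ?subr0 //.
  by split=> //; have := h [::] erefl; rewrite /total big_nil subr0.
case/andP=> k0 l0; rewrite /blocks_string /= -/(blocks_string l).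
split.
  move=> /(pass_win_block K _ _ _ _ k0) h [//|c cs] /= [sz].
  have [c' /(IH _ _ l0)/(_ cs sz)] := h c; congr K.
  by rewrite total_cons; lia.
move=> h; apply/(pass_win_block K _ _ _ _ k0) => c; exists false.
apply/(IH _ _ l0) => cs sz; have := h (c :: cs); rewrite /= sz => /(_ erefl).
by congr K; rewrite total_cons; lia.
Qed.

Lemma pass_win_exists K ch l z : all block_wf l ->
  pass_win K true (ExpectQuantifier false) ch (blocks_string l) 0 z <->
  exists2 c, size c = size l & K 0 (z - (total true c l)%:Z).
Proof.
elim: l ch z => [|k l IH] ch z /=.
  move=> _; split=> [[_ h]|]; first by exists [::];
    rewrite ?/total ?big_nil ?subr0.
  by move=> [[|//] _]; rewrite /total big_nil subr0.
case/andP=> k0 l0; rewrite /blocks_string /= -/(blocks_string l).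
split.
  move=> /(pass_win_block K _ _ _ _ k0) /(_ false)[c /(IH _ _ l0)[cs sz h]].
  exists (c :: cs); first by rewrite /= sz.
  by move: h; congr K; rewrite total_cons; lia.
move=> [[//|c cs] /= [sz] h]; apply/(pass_win_block K _ _ _ _ k0) => _;
  exists c.
apply/(IH _ _ l0); exists cs => //.
by move: h; congr K; rewrite total_cons; lia.
Qed.

Definition game_input (S : seq bool) (l : seq block) : seq ksym :=
  [seq Digit d | d <- S] ++ blocks_string l.

Lemma pass_win_start K p ch S l z : S != [::] -> l != [::] ->
  pass_win K p start ch (game_input S l) 0 z <->
  pass_win K p (ExpectQuantifier false) ch (blocks_string l) 0
    (z + (~~ p)%:R * (binval S)%:Z).
Proof.
move=> S0 l0.
rewrite /game_input; split.
  move=> /pass_win_digits; rewrite S0 foldl_binval.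
  by case: l l0 => //= k l _ h j; have := h j; rewrite mul0r addr0.
move=> h; apply/pass_win_digits; rewrite S0 foldl_binval.
by case: l l0 h => //= k l _ h j; have := h j; rewrite mul0r addr0.
Qed.

Definition winning_input (S : seq bool) (l : seq block) : Prop :=
  forall c, size c = size l -> exists2 c', size c' = size l &
    binval S = (total false c l + total true c' l)%N.

Lemma win_game_input S l : S != [::] -> l != [::] -> all block_wf l ->
  win (game_input S l) false start false (game_input S l) 0 0 <->
  winning_input S l.
Proof.
move=> S0 l0 lwf; rewrite /win /=.
split.
  move=> /(pass_win_start _ _ _ _ S0 l0) /(pass_win_forall _ _ _ lwf) h c sz.
  have /(pass_win_start _ _ _ _ S0 l0) := h c sz.
  move=> /(pass_win_exists _ _ _ lwf)[c' sz' e]; exists c' => //.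
  by move: e => /=; lia.
move=> h;
  apply/(pass_win_start _ _ _ _ S0 l0)/(pass_win_forall _ _ _ lwf) => c sz.
apply/(pass_win_start _ _ _ _ S0 l0)/(pass_win_exists _ _ _ lwf).
by have [c' sz' e] := h c sz; exists c' => //=; lia.
Qed.

(** * Recovering the blocks from a winning position *)

Definition quantifier_suffix (t : bool) (s : seq ksym) : Prop :=
  if t then exists e f l,
    [/\ e != [::], f != [::], all block_wf l
      & s = ExistsSym :: pair_string e f ++ blocks_string l]
  else exists2 l, all block_wf l & s = blocks_string l.

Definition location_suffix (q : location) (s : seq ksym) : Prop :=
  match q with
  | InNumeral None ne => exists u l,
      [/\ ne || (u != [::]), l != [::], all block_wf l
        & s = [seq Digit d | d <- u] ++ blocks_string l]
  | InNumeral (Some (t, false)) ne => exists u v s',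
      [/\ ne || (u != [::]), v != [::], quantifier_suffix (~~ t) s'
        & s = [seq Digit d | d <- u] ++
              Comma :: [seq Digit d | d <- v] ++ RParen :: s']
  | InNumeral (Some (t, true)) ne => exists v s',
      [/\ ne || (v != [::]), quantifier_suffix (~~ t) s'
        & s = [seq Digit d | d <- v] ++ RParen :: s']
  | ExpectParen t => exists u v s',
      [/\ u != [::], v != [::], quantifier_suffix (~~ t) s'
        & s = pair_string u v ++ s']
  | ExpectQuantifier t => quantifier_suffix t s
  end.

Lemma blocks_string_cons k l : blocks_string (k :: l) =
  ForallSym :: pair_string k.1.1 k.1.2 ++
    ExistsSym :: pair_string k.2.1 k.2.2 ++ blocks_string l.
Proof. by rewrite /blocks_string /= -catA. Qed.

(** Induction on the remaining input: each transition prepends its symbol to the decomposition. The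
    coins do not affect the syntax, so following the coin [false] is enough. *)
Lemma pass_win_suffix K p q ch s z1 z2 :
  pass_win K p q ch s z1 z2 -> location_suffix q s.
Proof.
elim: s q ch z1 z2 => [|x s IH] q ch z1 z2 /=.
  by case=> -> _; exists [::].
case E: (next_location q x) => [q'|//] /(_ false)[u /IH {IH}].
case: x E => [b||||| ]; case: q => [[[t []]|] [] | t | []] //= [<-] /=.
- by move=> [v [s' [_ h ->]]]; exists (b :: v), s'.
- by move=> [v [s' [_ h ->]]]; exists (b :: v), s'.
- by move=> [v [v' [s' [_ v0 h ->]]]]; exists (b :: v), v', s'.
- by move=> [v [v' [s' [_ v0 h ->]]]]; exists (b :: v), v', s'.
- by move=> [v [l [_ l0 lwf ->]]]; exists (b :: v), l.
- by move=> [v [l [_ l0 lwf ->]]]; exists (b :: v), l.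
- move=> [a [c [_ [a0 c0 [e [f [l [e0 f0 lwf ->]]]] ->]]]].
  exists [::], (((a, c), (e, f)) :: l); split=> //=;
    first by rewrite /block_wf /= a0 c0 e0 f0.
  by rewrite blocks_string_cons.
- move=> [a [c [_ [a0 c0 [e [f [l [e0 f0 lwf ->]]]] ->]]]].
  exists (((a, c), (e, f)) :: l) => //=;
    first by rewrite /block_wf /= a0 c0 e0 f0.
  by rewrite blocks_string_cons.
- move=> [e [f [_ [e0 f0 [l lwf ->] ->]]]].
  by exists e, f, l.
- move=> [v [v' [s' [v0 v'0 h ->]]]]; exists v, v', s'; split=> //.
  by rewrite /pair_string /= -!catA /= -!catA.
- by move=> [v [s' [v0 h ->]]]; exists [::], v, s'.
- by move=> h; exists [::], s.
Qed.

Lemma win_start_parse w : win w false start false w 0 0 ->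
  exists S l, [/\ S != [::], l != [::], all block_wf l & w = game_input S l].
Proof. by move=> /pass_win_suffix. Qed.

Lemma total_nth p k0 (c : seq bool) (l : seq block) : size c = size l ->
  total p c l =
  (\sum_(i < size l) block_value p (nth false c i) (nth k0 l i))%N.
Proof.
move=> sz; rewrite /total (big_nth (false, k0)) size_zip sz minnn big_mkord.
by apply: eq_bigr => i _; rewrite nth_zip.
Qed.

Lemma knapsack_gameP w : knapsack_game w <->
  exists S l, [/\ S != [::] /\ l != [::], all block_wf l, w = game_input S l
    & winning_input S l].
Proof.
pose k0 : block := (([::], [::]), ([::], [::])).
split.
  move=> [n [S [a [b [e [f [n0 [S0 wf] -> h]]]]]]].
  pose k i : block := ((a i, b i), (e i, f i)).
  pose l := [seq k i | i <- enum 'I_n].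
  have szl : size l = n by rewrite size_map size_enum_ord.
  have nthl (i : 'I_n) : nth k0 l i = k i.
    by rewrite (nth_map i) ?size_enum_ord // nth_ord_enum.
  exists S, l; split.
  - by split=> //; rewrite -size_eq0 szl -lt0n.
  - apply/allP => _ /mapP[i _ ->]; have [a0 b0 e0 f0] := wf i.
    by rewrite /block_wf /= a0 b0 e0 f0.
  - by rewrite /game_string /game_input /blocks_string /l -map_comp.
  move=> c szc.
  have [|y [hy ->]] := h (fun i => block_value false (nth false c i) (k i)).
    by move=> i; rewrite /block_value /=; case: nth; [right|left].
  (* Comparing values selects the first component when both have the same value. *)
  pose c' := [seq y i != binval (e i) | i <- enum 'I_n].
  have szc' : size c' = size l by rewrite !size_map.
  exists c' => //.
  rewrite !(total_nth _ k0) // szl big_split /=.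
  congr addn; apply: eq_bigr => i _; rewrite nthl //.
  rewrite (nth_map i) ?size_enum_ord // nth_ord_enum /block_value /=.
  by have [->|yf] := eqVneq (y i) (binval (e i)) => //; have [ye|] := hy i;
     rewrite ?ye ?eqxx // in yf *.
move=> [S [l [[S0 l0] lwf -> h]]].
pose g (i : 'I_(size l)) := nth k0 l i.
exists (size l), S, (fun i => (g i).1.1), (fun i => (g i).1.2),
  (fun i => (g i).2.1), (fun i => (g i).2.2); split.
- by rewrite lt0n size_eq0.
- split=> // i.
  by have /and4P[] : block_wf (g i) by apply: (allP lwf); apply: mem_nth.
- rewrite /game_input /game_string /blocks_string; congr (_ ++ flatten _).
  by rewrite -[in LHS](mkseq_nth k0 l) /mkseq -val_enum_ord -!map_comp.
move=> x hx.
pose c := [seq x i != binval (g i).1.1 | i <- enum 'I_(size l)].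
have szc : size c = size l by rewrite size_map size_enum_ord.
have [c' szc' ->] := h c szc.
exists (fun i : 'I__ => block_value true (nth false c' i) (g i)); split.
  by move=> i; rewrite /block_value /=; case: nth; [right|left].
rewrite !(total_nth _ k0) // big_split /=; congr addn; apply: eq_bigr => i _.
rewrite (nth_map i) ?size_enum_ord // nth_ord_enum /block_value /=.
have [->|xf] := eqVneq (x i) (binval (g i).1.1) => //.
by have [xe|//] := hx i; rewrite xe eqxx in xf.
Qed.

Lemma win_knapsack_game w : win w false start false w 0 0 <-> knapsack_game w.
Proof.
split=> [h|/knapsack_gameP[S [l [[S0 l0] lwf -> h]]]].
  have [S [l [S0 l0 lwf e]]] := win_start_parse h.
  apply/knapsack_gameP; exists S, l; split=> //.
  by apply/win_game_input => //; rewrite -e.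
exact/win_game_input.
Qed.

(** * Potentials and honest provers for arbitrary verifiers *)

Section SquaredNorm.
Context {R : realType} {m : nat}.
Implicit Types v : 'cV[R]_m.

Lemma sqnorm_ge0 v : 0 <= sqnorm v.
Proof. by apply: sumr_ge0 => i _; exact: sqr_ge0. Qed.

Lemma sqnormZ a v : sqnorm (a *: v) = a ^+ 2 * sqnorm v.
Proof.
by rewrite /sqnorm mulr_sumr; apply: eq_bigr => i _; rewrite mxE exprMn.
Qed.

Lemma sqnormE v : sqnorm v = (v^T *m v) 0 0.
Proof. by rewrite mxE; apply: eq_bigr => i _; rewrite mxE expr2. Qed.

Lemma sqnorm_normalize v : sqnorm v != 0 ->
  sqnorm ((Num.sqrt (sqnorm v))^-1 *: v) = 1.
Proof. by move=> v0; rewrite sqnormZ exprVn sqr_sqrtr ?sqnorm_ge0 // mulVf. Qed.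

Lemma sqnorm_superoperator (E : seq 'M[rat]_m) v : superoperator E ->
  \sum_(A <- E) sqnorm (map_mx ratr A *m v) = sqnorm v.
Proof.
case=> _ /(congr1 (map_mx (ratr : rat -> R))).
rewrite map_mx_sum map_mx1 => E1.
rewrite [RHS]sqnormE -[X in _ = (_ *m X) _ _]mul1mx -E1.
rewrite mulmx_suml mulmx_sumr summxE.
apply: eq_bigr => A _.
by rewrite sqnormE trmx_mul map_mxM map_trmx !mulmxA.
Qed.

End SquaredNorm.

Section Steps.
Context {R : realType} {Sigma : Type} {V : verifier Sigma}.
Implicit Types (P : prover R V) (w : seq Sigma) (c : config R V).

Definition operations w (s : state V) (i : nat) : seq 'M[rat]_(qdim V) :=
  delta_q s (tape_at w i).

Definition apply_op (A : 'M[rat]_(qdim V)) (v : 'cV[R]_(qdim V)) :=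
  map_mx ratr A *m v.

Definition outcome_vec w c (j : nat) : 'cV[R]_(qdim V) :=
  apply_op (nth 0 (operations w (cstate c) (chead c)) j) (cquantum c).

Definition read_next w c (j : nat) : config R V :=
  let r := delta_r (cstate c) (tape_at w (chead c)) j in
  Config r.1 (move_head r.2 (chead c))
    ((Num.sqrt (sqnorm (outcome_vec w c j)))^-1 *: outcome_vec w c j)
    (Outcome j :: chistory c).

Definition comm_next c (u : upsilon V) : config R V :=
  Config (delta_c (cstate c) u) (chead c) (cquantum c)
    (Response u :: Sent (write (cstate c)) :: chistory c).

Lemma sum_step_halted P w c (G : config R V -> R) : halted c ->
  \sum_(x <- step P w c) x.1 * G x.2 = G c.
Proof. by rewrite /step => ->; rewrite big_seq1 mul1r. Qed.

Lemma sum_step_comm P w c (G : config R V -> R) :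
  ~~ halted c -> is_comm (cstate c) ->
  \sum_(x <- step P w c) x.1 * G x.2 =
  \sum_u P w (Sent (write (cstate c)) :: chistory c) u * G (comm_next c u).
Proof.
by rewrite /step => /negPf-> ->; rewrite /comm_step big_map big_enum.
Qed.

Lemma sum_step_read P w c (G : config R V -> R) :
  ~~ halted c -> ~~ is_comm (cstate c) ->
  \sum_(x <- step P w c) x.1 * G x.2 =
  \sum_(j < size (operations w (cstate c) (chead c)))
     sqnorm (outcome_vec w c j) * G (read_next w c j).
Proof.
rewrite /step => /negPf-> /negPf->; rewrite /read_step big_map.
by rewrite -[X in iota 0 X]subn0 -/(index_iota 0 _) big_mkord.
Qed.

Lemma sum_outcomes w s i (v : 'cV[R]_(qdim V)) : ~~ is_comm s ->
  \sum_(j < size (operations w s i))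
    sqnorm (apply_op (nth 0 (operations w s i) j) v) = sqnorm v.
Proof.
move=> sr.
rewrite -(big_mkord xpredT (fun j => sqnorm (apply_op (nth 0 _ j) v))).
rewrite -(big_nth 0 xpredT (fun A => sqnorm (apply_op A v))).
exact/sqnorm_superoperator/delta_q_superoperator.
Qed.

Lemma step_ge0 P w c x : x \in [seq y.1 | y <- step P w c] -> 0 <= x.
Proof.
rewrite /step; case: ifP => _; first by rewrite inE => /eqP->.
case: ifP => _.
  by rewrite -map_comp => /mapP[u _ ->] /=; exact: Defs.pmf_ge0.
by rewrite -map_comp => /mapP[u _ ->] /=; exact: sqnorm_ge0.
Qed.

Lemma le_sum_step P w c (F G : config R V -> R) : (forall c', F c' <= G c') ->
  \sum_(x <- step P w c) x.1 * F x.2 <= \sum_(x <- step P w c) x.1 * G x.2.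
Proof.
move=> FG.
have : all (fun x => 0 <= x) [seq y.1 | y <- step P w c].
  by apply/allP => x; exact: step_ge0.
rewrite all_map; elim: (step P w c) => [|x l IH] /=; first by rewrite !big_nil.
by case/andP=> x0 l0; rewrite !big_cons lerD ?ler_wpM2l ?IH.
Qed.

Lemma sum_step1 P w c : sqnorm (cquantum c) = 1 ->
  \sum_(x <- step P w c) x.1 = 1.
Proof.
move=> v1; under eq_bigr do rewrite -[_.1]mulr1.
have [ch|cn] := boolP (halted c);
  first by rewrite (sum_step_halted _ _ (fun=> 1)).
have [sc|sr] := boolP (is_comm (cstate c)).
  rewrite (sum_step_comm _ _ (fun=> 1)) //; under eq_bigr do rewrite mulr1.
  exact: Defs.pmf_sum1.
rewrite (sum_step_read _ _ (fun=> 1)) //; under eq_bigr do rewrite mulr1.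
by rewrite sum_outcomes.
Qed.

Lemma prob_from_ge0 P w Q t c : 0 <= prob_from P w Q t c.
Proof.
elim: t c => [|t IH] c /=; first exact: ler0n.
have := le_sum_step (F := fun=> 0) P w c IH.
by rewrite big1 // => x _; rewrite mulr0.
Qed.

Lemma prob_fromS P w (Q : pred (config R V)) t c :
  (forall c', Q c' -> halted c') ->
  prob_from P w Q t c <= prob_from P w Q t.+1 c.
Proof.
move=> QH; elim: t c => [|t IH] c; last exact: (le_sum_step P w c IH).
case Qc: (Q c); rewrite /= Qc; last first.
  exact: (prob_from_ge0 P w Q 1 c).
by rewrite (sum_step_halted _ _ (fun c => (Q c)%:R)) ?QH ?Qc.
Qed.

Lemma prob_from_halted P w t c :
  prob_from P w halted t c =
  prob_from P w accepting t c + prob_from P w rejecting t c.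
Proof.
elim: t c => [|t IH] c /=.
  rewrite -natrD; congr _%:R; rewrite /halted /accepting /rejecting.
  have [->|_] := eqVneq (cstate c) (s_acc V); last by rewrite add0n.
  by rewrite (negPf (s_acc_neq_rej V)).
by rewrite -big_split; apply: eq_bigr => x _; rewrite IH mulrDr.
Qed.

(* [Phi] is a homogeneous quadratic function of the unnormalized quantum state,
   so that the probability of an outcome is absorbed by the normalization. *)
Record potential (w : seq Sigma) (Phi : state V -> nat -> 'cV[R]_(qdim V) -> R)
    (Inv : state V -> nat -> Prop) (cost : R) : Prop := Potential {
  potential_ge0 : forall s i v, Inv s i -> 0 <= Phi s i v;
  potentialZ : forall s i a v, Inv s i ->
    Phi s i (a *: v) <= a ^+ 2 * Phi s i v;
  potential_comm : forall s i v u, Inv s i -> s != s_acc V -> s != s_rej V ->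
    is_comm s ->
    Inv (delta_c s u) i /\ cost * sqnorm v + Phi (delta_c s u) i v <= Phi s i v;
  potential_read : forall s i, Inv s i -> s != s_acc V -> s != s_rej V ->
    ~~ is_comm s ->
    let E := operations w s i in
    let next j := delta_r s (tape_at w i) j in
    (forall j, (j < size E)%N -> Inv (next j).1 (move_head (next j).2 i)) /\
    forall v, cost * sqnorm v + \sum_(j < size E)
      Phi (next j).1 (move_head (next j).2 i) (apply_op (nth 0 E j) v)
      <= Phi s i v }.

(** A supermartingale argument, by induction on the number of steps. With [cost] 0, [F] will be the
    probability of an event, and with [cost] 1 the expected number of steps before halting. *)
Lemma potential_bound w Phi Inv cost P (F : nat -> config R V -> R) :
  potential w Phi Inv cost ->
  (forall c, Inv (cstate c) (chead c) -> sqnorm (cquantum c) = 1 ->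
     F 0 c <= Phi (cstate c) (chead c) (cquantum c)) ->
  (forall t c, sqnorm (cquantum c) = 1 ->
     F t.+1 c =
       cost * (~~ halted c)%:R + \sum_(x <- step P w c) x.1 * F t x.2) ->
  forall t c, Inv (cstate c) (chead c) -> sqnorm (cquantum c) = 1 ->
    F t c <= Phi (cstate c) (chead c) (cquantum c).
Proof.
move=> [Phi0 PhiZ Pcomm Pread] F0 FS; elim=> [|t IH] c Ic c1; first exact: F0.
rewrite FS //; have [ch|cn] := boolP (halted c).
  by rewrite mulr0 add0r sum_step_halted // IH.
have /norP[ca cr] := cn; rewrite mulr1.
have [sc|sr] := boolP (is_comm (cstate c)).
  (* The bound holds for each response, hence on average over the prover's distribution. *)
  rewrite sum_step_comm //; set p := P _ _.
  rewrite -[leRHS]mul1r -(Defs.pmf_sum1 p) mulr_suml.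
  rewrite -[cost]mul1r -(Defs.pmf_sum1 p) mulr_suml.
  rewrite -big_split /=; apply: ler_sum => u _.
  rewrite -mulrDr ler_wpM2l ?Defs.pmf_ge0 //.
  have [Iu] := Pcomm _ _ (cquantum c) u Ic ca cr sc.
  by rewrite c1 mulr1; apply: le_trans; rewrite lerD2l IH.
rewrite sum_step_read //.
have [In] := Pread _ _ Ic ca cr sr; move=> /(_ (cquantum c)).
rewrite c1 mulr1; apply: le_trans; rewrite lerD2l; apply: ler_sum => j _.
have Ij := In j (ltn_ord j).
rewrite -/(outcome_vec w c j).
(* An outcome of probability 0 cannot be normalized, but it contributes nothing, and [Phi] is
   nonnegative. *)
have [->|p0] := eqVneq (sqnorm (outcome_vec w c j)) 0.
  by rewrite mul0r Phi0.
have /= := IH (read_next w c j) Ij (sqnorm_normalize p0).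
move=> /(ler_wpM2l (sqnorm_ge0 (outcome_vec w c j))) /le_trans; apply.
(* The probability of the outcome cancels the square of the normalizing factor. *)
have := PhiZ _ _ (Num.sqrt (sqnorm (outcome_vec w c j)))^-1
  (outcome_vec w c j) Ij.
move=> /(ler_wpM2l (sqnorm_ge0 (outcome_vec w c j))) /le_trans; apply.
by rewrite exprVn sqr_sqrtr ?sqnorm_ge0 // mulrA mulfV // mul1r.
Qed.

End Steps.

Section Termination.
Context {R : realType} {Sigma : Type} {V : verifier Sigma}.
Implicit Types (P : prover R V) (w : seq Sigma) (c : config R V).

Lemma sqnorm_init : sqnorm (cquantum (init_config : config R V)) = 1.
Proof.
rewrite /sqnorm (bigD1 (q_init V)) //= big1 => [|i iq].
  by rewrite mxE !eqxx expr1n addr0.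
by rewrite mxE (negPf iq) expr0n.
Qed.

Lemma potential_sqnorm w :
  potential w (fun (_ : state V) (_ : nat) v => sqnorm v : R)
    (fun _ _ => True) 0.
Proof.
split=> [s i v _|s i a v _|s i v u _ _ _ _|s i _ _ _ sr /=].
- exact: sqnorm_ge0.
- by rewrite sqnormZ.
- by rewrite mul0r add0r.
- by split=> // v; rewrite mul0r add0r sum_outcomes.
Qed.

Lemma prob_after_le P w (Q : pred (config R V)) Phi Inv t :
  potential w Phi Inv 0 ->
  (forall s i v h, Inv s i -> sqnorm v = 1 -> Q (Config s i v h) ->
     1 <= Phi s i v) ->
  Inv (s_init V) 0%N ->
  prob_after P w Q t <= Phi (s_init V) 0%N (delta_mx (q_init V) 0).
Proof.
move=> pot Q1 I0; apply: (potential_bound pot) => //.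
- move=> [s i v h] /= Is v1.
  by case Qc: (Q _); [exact: Q1 Qc|apply: (potential_ge0 pot)].
- by move=> k c _; rewrite mul0r add0r.
- exact: sqnorm_init.
Qed.

Lemma prob_after_le1 P w Q t : prob_after P w Q t <= 1.
Proof.
have := prob_after_le (Q := Q) P t (potential_sqnorm w).
by rewrite sqnorm_init; apply=> // s i v h _ ->.
Qed.

Lemma nondecreasing_prob_after P w (Q : pred (config R V)) :
  (forall c, Q c -> halted c) ->
  {homo prob_after P w Q : m n / (m <= n)%N >-> m <= n}.
Proof. by move=> QH; apply/nondecreasing_seqP => t; apply: prob_fromS. Qed.

Lemma cvg_prob_after P w (Q : pred (config R V)) :
  (forall c, Q c -> halted c) -> cvgn (prob_after P w Q).
Proof.
move=> QH; apply: nondecreasing_is_cvgn; first exact: nondecreasing_prob_after.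
by exists 1 => _ [t _ <-]; exact: prob_after_le1.
Qed.

(** The summands are the probabilities of still running after [t] steps; their sum is the expected
    time truncated at [N], which satisfies the recursion of [potential_bound] with [cost] 1. *)
Lemma sum_running_le P w Phi Inv N :
  potential w Phi Inv 1 -> Inv (s_init V) 0%N ->
  \sum_(t < N) (1 - prob_after P w halted t) <=
  Phi (s_init V) 0%N (delta_mx (q_init V) 0).
Proof.
move=> pot I0.
apply: (potential_bound (P := P)
    (F := fun N c => \sum_(t < N) (1 - prob_from P w halted t c)) pot) => //.
- by move=> c Ic _; rewrite big_ord0 (potential_ge0 pot).
- move=> t c c1; rewrite big_ord_recl /=; congr (_ + _).
    by case: halted => /=; rewrite ?subrr ?subr0 ?mulr0 ?mulr1.
  under [RHS]eq_bigr do rewrite mulr_sumr.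
  rewrite exchange_big /=; apply: eq_bigr => k _.
  under [RHS]eq_bigr do rewrite mulrBr mulr1.
  by rewrite sumrB sum_step1.
- exact: sqnorm_init.
Qed.

(** If the limit were below 1, every summand would be at least the gap, and the sums would be
    unbounded. *)
Lemma lim_prob_halted P w (T : R) :
  (forall N, \sum_(t < N) (1 - prob_after P w halted t) <= T) ->
  limn (prob_after P w halted) = 1.
Proof.
move=> hT; set p := prob_after P w halted.
have cp : cvgn p by exact: cvg_prob_after.
have nd : nondecreasing_seq p by exact: nondecreasing_prob_after.
apply/eqP; rewrite eq_le; apply/andP; split.
  by apply: limr_le => //; near=> t; exact: prob_after_le1.
rewrite leNgt; apply/negP => l1.
have e0 : 0 < 1 - limn p by rewrite subr_gt0.
have T0 : 0 <= T by have := hT 0%N; rewrite big_ord0.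
pose N := Num.truncn (T / (1 - limn p)).
have : N.+1%:R * (1 - limn p) <= T.
  apply: le_trans (hT N.+1);
    rewrite mulr_natl -[X in _ *+ X]card_ord -sumr_const.
  by apply: ler_sum => t _; rewrite lerB // nondecreasing_cvgn_le.
apply/negP; rewrite -ltNge -ltr_pdivrMr //.
by rewrite truncnS_gt.
Unshelve. all: by end_near.
Qed.

Lemma expected_time_le P w (T : R) :
  (forall N, \sum_(t < N) (1 - prob_after P w halted t) <= T) ->
  (expected_time P w <= T%:E)%E.
Proof.
move=> hT; rewrite /expected_time (lim_prob_halted hT) subrr mule0 adde0.
set p := prob_after P w halted.
have nd t : p t <= p t.+1 by apply: nondecreasing_prob_after.
apply: lime_le.
  apply: is_cvg_nneseries => t _ _.
  by rewrite lee_fin mulr_ge0 // subr_ge0.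
near=> N; rewrite sumEFin lee_fin.
apply: le_trans (hT N); rewrite -(big_mkord xpredT (fun t => 1 - p t)).
(* Summation by parts; the boundary term has the favourable sign. *)
suff -> : \sum_(0 <= t < N) t.+1%:R * (p t.+1 - p t) =
    \sum_(0 <= t < N) (1 - p t) - N%:R * (1 - p N).
  by rewrite gerBl mulr_ge0 // subr_ge0 prob_after_le1.
elim: (N : nat) => [|k IH]; first by rewrite !big_nil mul0r subr0.
by rewrite !big_nat_recr //= IH; ring.
Unshelve. all: by end_near.
Qed.

(** Halting is almost sure, so it is enough to bound the probability of acceptance from above. *)
Lemma reject_prob_ge P w (T r : R) :
  (forall N, \sum_(t < N) (1 - prob_after P w halted t) <= T) ->
  (forall t, prob_after P w accepting t <= r) ->
  1 - r <= reject_prob P w.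
Proof.
move=> hT hr; rewrite -(lim_prob_halted hT) /reject_prob.
have ch : cvgn (prob_after P w halted) by exact: cvg_prob_after.
have rej_halted c : rejecting c -> halted c by rewrite /halted orbC => ->.
rewrite lerBlDr; apply: limr_le => //; near=> t.
rewrite /prob_after prob_from_halted addrC lerD //; last exact: hr.
apply: nondecreasing_cvgn_le; first exact: nondecreasing_prob_after.
exact: cvg_prob_after.
Unshelve. all: by end_near.
Qed.

Lemma accept_prob1 P w (T : R) :
  (forall N, \sum_(t < N) (1 - prob_after P w halted t) <= T) ->
  (forall t, prob_after P w rejecting t = 0) ->
  accept_prob P w = 1.
Proof.
move=> hT hr; rewrite -(lim_prob_halted hT) /accept_prob; congr (limn _).
apply/funext => t; rewrite {2}/prob_after prob_from_halted.
by rewrite -/(prob_after P w rejecting t) hr addr0.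
Qed.

End Termination.

Section HonestProver.
Context {R : realType} {Sigma : Type} {V : verifier Sigma}.
Implicit Types (P : prover R V) (w : seq Sigma) (c : config R V).

(** The coins being public, the prover can recompute the whole configuration, quantum state
    included, from the events alone. *)
Fixpoint replay w (h : seq (event (upsilon V))) : config R V :=
  match h with
  | Outcome j :: h' => read_next w (replay w h') j
  | Response u :: Sent _ :: h' => comm_next (replay w h') u
  | _ => init_config
  end.

Lemma point_mass_ge0 (T : finType) (x y : T) : 0 <= (y == x)%:R :> R.
Proof. exact: ler0n. Qed.

Lemma point_mass_sum1 (T : finType) (x : T) : \sum_y (y == x)%:R = 1 :> R.
Proof. by rewrite (bigD1 x) //= eqxx big1 ?addr0 // => y /negPf->. Qed.

Definition point_mass (T : finType) (x : T) : Defs.distribution R T :=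
  Distribution (point_mass_ge0 x) (point_mass_sum1 x).

Context (Good : seq Sigma -> state V -> nat -> 'cV[R]_(qdim V) -> Prop).

Definition good w c : Prop := Good w (cstate c) (chead c) (cquantum c).

(** [behead] removes the pending [Sent] event, which [replay] expects only below a response. The
    default is just some element of [upsilon V]. *)
Definition honest_response w (h : seq (event (upsilon V))) : upsilon V :=
  if [pick u | `[< good w (comm_next (replay w (behead h)) u) >]] is Some u
  then u else write (s_init V).

Definition honest_prover : prover R V :=
  fun w h => point_mass (honest_response w h).

(** [Good] is an invariant that some response, and every outcome of nonzero probability, preserves.
    The factor [a] stands for the normalization. *)
Lemma honest_prover_wins w t :
  Good w (s_init V) 0%N (delta_mx (q_init V) 0) ->
  (forall s i v, Good w s i v -> s != s_rej V) ->
  (forall s i v, Good w s i v -> s != s_acc V -> is_comm s ->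
     exists u, Good w (delta_c s u) i v) ->
  (forall s i v j, Good w s i v -> s != s_acc V -> ~~ is_comm s ->
     let E := operations w s i in
     let r := delta_r s (tape_at w i) j in
     (j < size E)%N -> sqnorm (apply_op (nth 0 E j) v) != 0 ->
     forall a, Good w r.1 (move_head r.2 i) (a *: apply_op (nth 0 E j) v)) ->
  prob_after honest_prover w rejecting t = 0.
Proof.
move=> G0 Grej Gcomm Gread.
suff H c : good w c -> replay w (chistory c) = c ->
    prob_from honest_prover w rejecting t c = 0 by exact: H.
elim: t c => [|t IH] c gc rc /=;
  first by rewrite /rejecting (negPf (Grej _ _ _ gc)).
have [ch|cn] := boolP (halted c); first by rewrite sum_step_halted // IH.
have /norP[ca cr] := cn.
have [sc|sr] := boolP (is_comm (cstate c)).
  rewrite sum_step_comm // big1 // => u _ /=.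
  have [->|_] := eqVneq; last by rewrite mul0r.
  rewrite mul1r; apply: IH; last by rewrite /= rc.
  rewrite /honest_response /= rc; case: pickP => [v /asboolP //|none].
  have [v gv] := Gcomm _ _ _ gc ca sc.
  by have /asboolP := none v.
rewrite sum_step_read // big1 // => j _.
have [->|p0] := eqVneq (sqnorm (outcome_vec w c j)) 0; first by rewrite mul0r.
rewrite IH ?mulr0 //; last by rewrite /= rc.
exact: Gread.
Qed.

End HonestProver.

(** * Completing a matrix to a superoperator *)

Definition frobenius2 m (A : 'M[rat]_m) : rat := \sum_i \sum_j A i j ^+ 2.

(** Applied to [v], it yields [A i j * v k - A i k * v j] in row [i]: a term of Lagrange's identity
    for [v] and that row of [A]. *)
Definition minor_mx m (A : 'M[rat]_m) (i j k : 'I_m) : 'M[rat]_m :=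
  A i j *: delta_mx i k - A i k *: delta_mx i j.

(* A nonnegative rational is the sum of [|numq r| * denq r] copies of the square
   of [(denq r)^-1]. *)
Definition scalar_ops m (r : rat) : seq 'M[rat]_m :=
  nseq (`|numq r| * `|denq r|) (((denq r)%:~R)^-1)%:M.

(* Lagrange's identity makes the minors complete a pair of copies of [A] to a
   multiple of the identity. *)
Definition complete m (A : 'M[rat]_m) : seq 'M[rat]_m :=
  A :: A :: [seq minor_mx A x.1.1 x.1.2 x.2 | x : 'I_m * 'I_m * 'I_m] ++
  scalar_ops m (1 - 2 * frobenius2 A).

Lemma sum_delta (I : finType) (p : I) (f : I -> rat) :
  \sum_k (k == p)%:R * f k = f p.
Proof.
by rewrite (bigD1 p) //= eqxx mul1r big1 ?addr0 // => k /negPf->; rewrite mul0r.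
Qed.

(** Lagrange's identity row by row. Each unordered pair of columns occurs twice, whence the factor
    2, which calls for two copies of [A] in [complete]. *)
Lemma sum_minor_mx m (A : 'M[rat]_m) :
  \sum_(x : 'I_m * 'I_m * 'I_m)
     (minor_mx A x.1.1 x.1.2 x.2)^T *m minor_mx A x.1.1 x.1.2 x.2 =
  (2 * frobenius2 A)%:M - 2 *: (A^T *m A).
Proof.
pose L i j k := (minor_mx A i j k)^T *m minor_mx A i j k.
rewrite -(pair_bigA _ (fun x k => L x.1 x.2 k)) /=.
rewrite -(pair_bigA _ (fun i j => \sum_k L i j k)) /=.
apply/matrixP => p q; rewrite summxE.
have E i j k : L i j k p q =
  (A i j * (k == p)%:R - A i k * (j == p)%:R) *
  (A i j * (k == q)%:R - A i k * (j == q)%:R).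
  rewrite !mxE (bigD1 i) //= big1 => [|s si].
    by rewrite !mxE eqxx /= addr0 ![_ == p]eq_sym ![_ == q]eq_sym.
  by rewrite !mxE (negPf si) /= !(mulr0, subrr, mul0r).
have F i : (\sum_j \sum_k L i j k) p q =
    2 * (\sum_j A i j ^+ 2) * (p == q)%:R - 2 * (A i p * A i q).
  rewrite summxE.
  transitivity (\sum_j (A i j ^+ 2 * (p == q)%:R
    - (j == q)%:R * (A i j * A i p) - (j == p)%:R * (A i j * A i q)
    + (j == p)%:R * ((j == q)%:R * \sum_k A i k ^+ 2))).
    apply: eq_bigr => j _; rewrite summxE.
    transitivity (\sum_k ((k == p)%:R * (A i j ^+ 2 * (k == q)%:R)
      - (k == p)%:R * ((j == q)%:R * (A i j * A i k))
      - (k == q)%:R * ((j == p)%:R * (A i j * A i k))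
      + (j == p)%:R * (j == q)%:R * A i k ^+ 2)).
      by apply: eq_bigr => k _; rewrite E; ring.
    by rewrite big_split /= !sumrB !sum_delta -mulr_sumr; ring.
  rewrite big_split /= !sumrB !sum_delta -mulr_suml.
  by ring.
rewrite (eq_bigr _ (fun i _ => F i)) sumrB -mulr_suml -!mulr_sumr !mxE.
rewrite mulr_natr.
congr (_ - _ * _); apply: eq_bigr => i _; by rewrite mxE.
Qed.

Lemma sum_scalar_ops m (r : rat) : 0 <= r ->
  \sum_(A <- scalar_ops m r) A^T *m A = r%:M.
Proof.
move=> r0; rewrite big_nseq iter_addr_0 tr_scalar_mx -scalar_mxM -raddfMn.
rewrite -mulr_natr.
congr _%:M.
rewrite -[RHS]divq_num_den natrM !natr_absz normr_denq.
rewrite (ger0_norm (_ : 0 <= numq r)) ?numq_ge0 //.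
have d0 : (denq r)%:~R != 0 :> rat by rewrite intr_eq0 denq_neq0.
by field.
Qed.

Lemma superoperator_complete m (A : 'M[rat]_m) :
  2 * frobenius2 A <= 1 -> superoperator (complete A).
Proof.
move=> hA; split=> //; rewrite !big_cons big_cat /= big_image /= sum_minor_mx.
rewrite sum_scalar_ops ?subr_ge0 //; apply/matrixP => i j; rewrite !mxE.
by case: (i == j) => /=; ring.
Qed.

Lemma superoperator1 m : superoperator [:: 1%:M : 'M[rat]_m].
Proof. by split=> //; rewrite big_seq1 trmx1 mulmx1. Qed.

(** A measurement in the computational basis, followed by the preparation of the state [f i] on
    outcome [i]. *)
Lemma superoperator_columns m (f : 'I_m -> 'cV[rat]_m) : (0 < m)%N ->
  (forall i, (f i)^T *m f i = 1%:M) ->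
  superoperator [seq f i *m delta_mx 0 i | i : 'I_m].
Proof.
move=> m0 hf; split; first by rewrite size_map -cardE card_ord.
rewrite big_image /=; apply/matrixP => p q; rewrite summxE.
have E i : (f i *m delta_mx 0 i)^T *m (f i *m delta_mx 0 i)
    = delta_mx i i :> 'M[rat]_m.
  rewrite trmx_mul -mulmxA (mulmxA _ (f i)) hf mul1mx trmx_delta.
  by rewrite mul_delta_mx.
rewrite (eq_bigr (fun i : 'I_m => (i == p)%:R * (p == q)%:R)).
  by rewrite sum_delta mxE.
move=> i _; rewrite E mxE eq_sym; case: eqVneq => [->|]; rewrite ?mul0r //.
by rewrite mul1r eq_sym.
Qed.

(** * The verifier *)

(** [Restart] and [Back] bring the head to the left end, before the first and the second pass; [Run]
    reads a symbol, and [Ask] waits for the prover's bit. *)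
Inductive control : Type :=
  | Accept | Reject | Restart | Back
  | Run of bool & location & bool
  | Ask of bool & location & bool.

Definition control_code (s : control) :
    bool * bool + bool * (bool * location * bool) :=
  match s with
  | Accept => inl (true, true)
  | Reject => inl (true, false)
  | Restart => inl (false, true)
  | Back => inl (false, false)
  | Run p q ch => inr (true, (p, q, ch))
  | Ask p q ch => inr (false, (p, q, ch))
  end.

Definition control_decode
    (x : bool * bool + bool * (bool * location * bool)) : control :=
  match x with
  | inl (true, true) => Accept
  | inl (true, false) => Reject
  | inl (false, true) => Restart
  | inl (false, false) => Back
  | inr (true, (p, q, ch)) => Run p q ch
  | inr (false, (p, q, ch)) => Ask p q ch
  end.

Lemma control_codeK : cancel control_code control_decode.
Proof. by case. Qed.

HB.instance Definition _ := Finite.copy control (can_type control_codeK).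

Definition mx_of_rows (rows : seq (seq rat)) : 'M[rat]_4 :=
  \matrix_(i, j) nth 0 (nth [::] rows i) j.

(* Up to a common factor, the register holds [1], the numeral being read, the
   balance, and a fourth amplitude halved at each symbol, whose square is the
   probability of acceptance. *)
Definition symbol_mx p q ch (x : ksym) : 'M[rat]_4 :=
  mx_of_rows
    (if x is Digit b then
       [:: [:: 4^-1; 0; 0; 0]; [:: b%:R / 4; 2^-1; 0; 0];
           [:: 0; 0; 4^-1; 0]; [:: 0; 0; 0; 8^-1]]
     else
       [:: [:: 4^-1; 0; 0; 0]; [:: 0; 0; 0; 0];
           [:: 0; (coefficient p q ch)%:~R / 4; 4^-1; 0]; [:: 0; 0; 0; 8^-1]]).

(** The triple 3, 4, 5 provides a rational unit vector. *)
Definition start_col : 'cV[rat]_4 := \col_i nth 0 [:: 4 / 5; 0; 0; 3 / 5] i.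

Definition column_ops (f : 'I_4 -> 'cV[rat]_4) : seq 'M[rat]_4 :=
  [seq f i *m delta_mx 0 i | i : 'I_4].

Definition control_ops (s : control) (t : tape_symbol ksym) : seq 'M[rat]_4 :=
  match t, s with
  | Sym x, Run p q ch => complete (symbol_mx p q ch x)
  | RightEnd, Run true _ _ => column_ops (fun i => delta_mx i 0)
  | LeftEnd, Restart => column_ops (fun _ => start_col)
  | _, _ => [:: 1%:M]
  end.

(** Outcomes 0 and 1 on a symbol are the two copies of the symbol's matrix: they are equally likely
    and serve as a fair coin. At the right end, outcome 2 detects a nonzero balance and outcome 3 is
    the small amplitude. *)
Definition control_move (s : control) (t : tape_symbol ksym) (j : nat) :
    control * direction :=
  match s, t with
  | Run p q ch, Sym x =>
      if next_location q x is Some q' then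
        match j with
        | 0 => (Ask p q' (choose_after false q' false ch), MoveRight)
        | 1 => (Ask p q' (choose_after false q' true ch), MoveRight)
        | _ => (Restart, Stay)
        end
      else (Reject, Stay)
  | Run p q _, RightEnd =>
      if q == ExpectQuantifier false then
        if p then
          match j with
          | 2 => (Reject, Stay)
          | 3 => (Accept, Stay)
          | _ => (Restart, Stay)
          end
        else (Back, Stay)
      else (Reject, Stay)
  | Run _ _ _, LeftEnd => (Restart, Stay)
  | Back, LeftEnd => (Run true start false, MoveRight)
  | Back, _ => (Back, MoveLeft)
  | Restart, LeftEnd => (Run false start false, MoveRight)
  | Restart, _ => (Restart, MoveLeft)
  | _, _ => (s, Stay)
  end.

Definition control_comm (s : control) (u : bool) : control :=
  if s is Ask p q ch then Run p q (choose_after true q u ch) else s.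

Definition is_ask (s : control) : bool :=
  if s is Ask _ _ _ then true else false.

Definition mx4E :=
  (big_ord_recl, big_ord0, mxE, addr0).

(** The common factor 1/4 makes room for the doubling of the numeral: the worst case, the digit 1,
    gives 29/32. *)
Lemma symbol_mx_small p q ch x : 2 * frobenius2 (symbol_mx p q ch x) <= 1.
Proof.
have c1 : (coefficient p q ch)%:~R ^+ 2 <= 1 :> rat.
  case: q => [[[t b]|] ?|?|?] /=; rewrite ?expr0n //; last by case: p.
  by case: (_ && _); rewrite ?rmorphN ?sqrrN ?expr0n ?expr1n.
rewrite /frobenius2; case: x => [b||||| ]; rewrite !mx4E /=; last 5 first.
all: try by move: c1; set c := _%:~R => c1; nra.
by case: b; vm_compute.
Qed.

Lemma control_ops_superoperator s t :
  ~~ is_ask s -> superoperator (control_ops s t).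
Proof.
case: s => [| | | |p q ch|//] _; case: t => [|x|] /=; try exact: superoperator1.
- apply: superoperator_columns => // i; apply/matrixP => a b.
  by rewrite !ord1 !mx4E /=; lra.
- exact/superoperator_complete/symbol_mx_small.
- case: p; last exact: superoperator1.
  apply: superoperator_columns => // i.
  by rewrite trmx_delta mul_delta_mx; apply/matrixP => a b; rewrite !ord1 !mxE.
Qed.

Lemma control_left_end s j :
  ~~ is_ask s -> (control_move s LeftEnd j).2 <> MoveLeft.
Proof. by case: s. Qed.

Lemma control_right_end s j :
  ~~ is_ask s -> (control_move s RightEnd j).2 <> MoveRight.
Proof.
by case: s => //= p q _ _; case: ifP => //; case: p => //;
  case: j => [|[|[|[]]]].
Qed.

Definition game_verifier : verifier ksym :=
  @Verifier ksym control is_ask 4 bool (fun _ => true) control_comm control_ops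
    control_move Restart ord0 Accept Reject isT control_ops_superoperator
    control_left_end control_right_end.

(** * Action of the operations on the register *)

Notation o0 := (ord0 : 'I_4).
Notation o1 := (lift ord0 ord0 : 'I_4).
Notation o2 := (lift ord0 (lift ord0 ord0) : 'I_4).
Notation o3 := (lift ord0 (lift ord0 (lift ord0 ord0)) : 'I_4).

Section Register.
Context {R : realType}.
Implicit Types v : 'cV[R]_4.

Definition act (A : 'M[rat]_4) v : 'cV[R]_4 := map_mx ratr A *m v.

Lemma act1 v : act 1%:M v = v.
Proof. by rewrite /act map_mx1 mul1mx. Qed.

Lemma sqnorm4 v :
  sqnorm v = v o0 0 ^+ 2 + v o1 0 ^+ 2 + v o2 0 ^+ 2 + v o3 0 ^+ 2.
Proof. by rewrite /sqnorm !big_ord_recl big_ord0 addr0 !addrA. Qed.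

Definition coords v (z1 z2 : int) : Prop :=
  v o1 0 = z1%:~R * v o0 0 /\ v o2 0 = z2%:~R * v o0 0.

Lemma coordsZ a v z1 z2 : coords v z1 z2 -> coords (a *: v) z1 z2.
Proof. by case=> h1 h2; split; rewrite !mxE ?h1 ?h2 mulrCA. Qed.

Lemma act_symbol0 p q ch x v : act (symbol_mx p q ch x) v o0 0 = v o0 0 / 4.
Proof.
by rewrite /act !mx4E; case: x => [b||||| ] /=;
  rewrite ?rmorph0 ?fmorphV ?rmorph_nat; field.
Qed.

Lemma act_symbol3 p q ch x v : act (symbol_mx p q ch x) v o3 0 = v o3 0 / 8.
Proof.
by rewrite /act !mx4E; case: x => [b||||| ] /=;
  rewrite ?rmorph0 ?fmorphV ?rmorph_nat; field.
Qed.

Lemma coords_symbol p q ch x v z1 z2 : coords v z1 z2 ->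
  coords (act (symbol_mx p q ch x) v) (current_update x z1)
    (balance_update p q ch x z1 z2).
Proof.
by case=> h1 h2; split; rewrite act_symbol0 /act !mx4E; case: x => [b||||| ] /=;
  rewrite ?h1 ?h2 ?rmorph0 ?rmorphM ?fmorphV ?rmorph_nat ?ratr_int;
  rewrite ?rmorphD ?rmorphM ?rmorph_nat ?rmorph0 /=; field.
Qed.

(** The outcomes from 2 on are treated alike, so only their total weight matters, which is what the
    two copies of [A] leave. *)
Lemma sum_complete (G : nat -> 'cV[R]_4 -> R) K A v :
  superoperator (complete A) -> (forall j u, G j.+2 u = K * sqnorm u) ->
  \sum_(j < size (complete A)) G j (act (nth 0 (complete A) j) v) =
  G 0 (act A v) + G 1 (act A v) + K * (sqnorm v - 2 * sqnorm (act A v)).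
Proof.
rewrite /complete; move: (_ ++ _) => l /sqnorm_superoperator E GK.
rewrite -(E R v) !big_cons -/(act A v) /= !big_ord_recl /= addrA; congr (_ + _).
rewrite (_ : _ - _ = \sum_(B <- l) sqnorm (act B v)); last by rewrite /act;
  ring.
rewrite mulr_sumr (big_nth 0) big_mkord.
by apply: eq_bigr => j _; rewrite GK.
Qed.

Lemma act_symbol_contracts p q ch x v :
  2 * sqnorm (act (symbol_mx p q ch x) v) <= sqnorm v.
Proof.
have := sum_complete (G := fun j u => (1 < j)%:R * sqnorm u) (K := 1) v
  (superoperator_complete (symbol_mx_small p q ch x)) (fun j u => erefl).
rewrite /= !mul0r !add0r mul1r -[_ <= _]subr_ge0 => <-.
by apply: sumr_ge0 => j _; rewrite mulr_ge0 ?sqnorm_ge0.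
Qed.

Lemma size_column_ops f : size (column_ops f) = 4%N.
Proof. by rewrite size_map -cardE card_ord. Qed.

Lemma act_column f (i : 'I_4) v :
  act (nth 0 (column_ops f) i) v = v i 0 *: map_mx ratr (f i).
Proof.
rewrite (nth_map i) -?cardE ?card_ord // nth_ord_enum /act map_mxM map_delta_mx.
rewrite -mulmxA -rowE; apply/matrixP => a b; rewrite !mxE big_ord1 !mxE !ord1.
by rewrite mulrC.
Qed.

Lemma sum_columns (G : nat -> 'cV[R]_4 -> R) f v :
  \sum_(j < size (column_ops f)) G j (act (nth 0 (column_ops f) j) v) =
  \sum_(i < 4) G i (v i 0 *: map_mx ratr (f i)).
Proof.
rewrite -(big_mkord xpredT (fun j => G j (act (nth 0 (column_ops f) j) v))).
by rewrite size_column_ops big_mkord; apply: eq_bigr => i _; rewrite act_column.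
Qed.

End Register.

(** * Soundness, running time and completeness *)

Section Potentials.
Context {R : realType} (w : seq ksym).
Let L := size w.
Implicit Types (s : control) (i : nat) (v : 'cV[R]_4).

Lemma tape_atS k :
  tape_at w k.+1 = if drop k w is x :: _ then Sym x else RightEnd.
Proof.
by rewrite /tape_at /=; elim: w k => [|x l IH] [|k] //=.
Qed.

Definition head_ok s i : Prop :=
  (i <= L.+1)%N &&
  (match s with Run _ _ _ | Ask _ _ _ => 0 < i | _ => true end)%N.

Definition symbols_left s i : nat :=
  match s with
  | Run p _ _ | Ask p _ _ => (L.+1 - i) + (if p then 0 else L)
  | Back => L
  | _ => 0
  end.

Definition win_pos s i (z1 z2 : int) : Prop :=
  match s with
  | Run p q ch => win w p q ch (drop i.-1 w) z1 z2
  | Ask p q ch => exists u,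
      win w p q (choose_after true q u ch) (drop i.-1 w) z1 z2
  | Back => win w true start false w z1 z2
  | _ => True
  end.

Definition lost s i v : bool :=
  `[< exists z1 z2, coords v z1 z2 /\ ~ win_pos s i z1 z2 >].

Lemma lostP s i v :
  reflect (exists z1 z2, coords v z1 z2 /\ ~ win_pos s i z1 z2) (lost s i v).
Proof. exact: asboolP. Qed.

(** Only an inequality: for [a = 0] all integers become coordinates. This is why potentials are
    merely required to satisfy an inequality under scaling. *)
Lemma lostZ s i a v : (lost s i v <= lost s i (a *: v))%N.
Proof.
case: lostP => // -[z1 [z2 [c h]]]; rewrite lt0b; apply/lostP.
by exists z1, z2; split=> //; exact: coordsZ.
Qed.

(** Per symbol, the square of the fourth amplitude is divided by 64 but survives in two outcomes,
    whence the base 32. The square of the first is divided by 16, and a lost position is sure to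
    stay lost for only one of the two coins, whence the base 16. *)
Definition inv_pow (a : R) s i : R := a^-1 ^+ symbols_left s i.

Lemma inv_pow_ge0 a s i : 0 <= a -> 0 <= inv_pow a s i.
Proof. by move=> a0; rewrite exprn_ge0 // invr_ge0. Qed.

Lemma inv_pow_le1 a s i : 1 <= a -> inv_pow a s i <= 1.
Proof.
move=> a1; have a0 : 0 < a by lra.
by apply: exprn_ile1; rewrite ?invr_ge0 ?invf_le1 // ltW.
Qed.

(* A restart is worth [2 / 5] to the prover; in a round that it has lost, the
   gain from a possible acceptance is outweighed by that of a rejection. *)
Definition accept_potential s i v : R :=
  match s with
  | Accept => sqnorm v
  | Reject => 0
  | Restart => 2 / 5 * sqnorm v
  | _ => 2 / 5 * sqnorm v + 3 / 5 * (inv_pow 32 s i * v o3 0 ^+ 2)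
         - 2 / 5 * (inv_pow 16 s i * v o0 0 ^+ 2 * (lost s i v)%:R)
  end.

Lemma sqnorm4_ge v : v o0 0 ^+ 2 <= sqnorm v /\ v o3 0 ^+ 2 <= sqnorm v.
Proof.
rewrite sqnorm4; split; last by rewrite lerDr !addr_ge0 ?sqr_ge0.
by rewrite -!addrA lerDl !addr_ge0 ?sqr_ge0.
Qed.

Lemma inv_pow_mul_le a s i (x y : R) : 1 <= a -> 0 <= x <= y ->
  0 <= inv_pow a s i * x <= y.
Proof.
move=> a1 /andP[x0 xy]; have := inv_pow_ge0 s i (le_trans ler01 a1).
by have := inv_pow_le1 s i a1; nra.
Qed.

Lemma accept_potential_ge0 s i v : 0 <= accept_potential s i v.
Proof.
have [h0 h3] := sqnorm4_ge v.
have v0 := sqnorm_ge0 v.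
have h : 0 <= 2 / 5 * sqnorm v + 3 / 5 * (inv_pow 32 s i * v o3 0 ^+ 2)
         - 2 / 5 * (inv_pow 16 s i * v o0 0 ^+ 2 * (lost s i v)%:R).
  have := @inv_pow_mul_le 32 s i (v o3 0 ^+ 2) (sqnorm v); rewrite sqr_ge0 h3.
  have := @inv_pow_mul_le 16 s i (v o0 0 ^+ 2) (sqnorm v); rewrite sqr_ge0 h0.
  set x := inv_pow _ _ _ * _; set y := inv_pow _ _ _ * _.
  move=> /(_ _ isT)/andP[]; first lra.
  move=> ? ? /(_ _ isT)/andP[]; first lra.
  by move=> ? ?; case: (lost _ _ _) => /=; lra.
by case: s h => //= *; lra.
Qed.

Lemma accept_potentialZ s i a v :
  accept_potential s i (a *: v) <= a ^+ 2 * accept_potential s i v.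
Proof.
have h : 2 / 5 * sqnorm (a *: v) + 3 / 5 * (inv_pow 32 s i * (a *: v) o3 0 ^+ 2)
         - 2 / 5 *
           (inv_pow 16 s i * (a *: v) o0 0 ^+ 2 * (lost s i (a *: v))%:R)
  <= a ^+ 2 * (2 / 5 * sqnorm v + 3 / 5 * (inv_pow 32 s i * v o3 0 ^+ 2)
         - 2 / 5 * (inv_pow 16 s i * v o0 0 ^+ 2 * (lost s i v)%:R)).
  have := lostZ s i a v; rewrite -(ler_nat R) sqnormZ !mxE.
  set l := (lost s i v)%:R; set l' := (lost s i _)%:R => ll'.
  set x := inv_pow _ _ _; set y := inv_pow _ _ _.
  have : 0 <= y * (a * v o0 0) ^+ 2 by rewrite mulr_ge0 ?sqr_ge0 // inv_pow_ge0.
  move=> /ler_wpM2l /(_ _ _ ll'). lra.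
by case: s h => //= *; rewrite ?sqnormZ; lra.
Qed.

Lemma drop_consE k x l : drop k w = x :: l -> (k < L)%N /\ drop k.+1 w = l.
Proof.
move=> E; split; last by rewrite -add1n -drop_drop E /= drop0.
by rewrite -subn_gt0 -size_drop E.
Qed.

Lemma drop_nilE k : drop k w = [::] -> (L <= k)%N.
Proof. by move=> E; rewrite -subn_eq0 -size_drop E. Qed.

Lemma head_ok_read s i j : head_ok s i -> ~~ is_ask s ->
  let r := control_move s (tape_at w i) j in head_ok r.1 (move_head r.2 i).
Proof.
rewrite /head_ok => /andP[iL i0] sa; case: i iL i0 => [|k] iL i0.
  by case: s i0 sa => //= *; rewrite ?andbT; apply/andP; split.
rewrite tape_atS; case E: (drop k w) => [|x l];
  last have [kL _] := drop_consE E.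
- case: s i0 sa => //= *; rewrite ?andbT //; try lia.
  by case: ifP => _; [case: ifP => _; [case: j => [|[|[|[|j]]]]|]|] => /=;
    rewrite ?andbT.
- case: s i0 sa => //= *; rewrite ?andbT //; try lia.
  by case: next_location => [q'|]; [case: j => [|[|j]]|] => /=; rewrite ?andbT.
Qed.

Section RoundSums.
Variable Phi : control -> nat -> 'cV[R]_4 -> R.

Definition round_sum s i v : R :=
  \sum_(j < size (control_ops s (tape_at w i)))
    Phi (control_move s (tape_at w i) j).1
      (move_head (control_move s (tape_at w i) j).2 i)
      (act (nth 0 (control_ops s (tape_at w i)) j) v).

Lemma round_sum1 s i v : control_ops s (tape_at w i) = [:: 1%:M] ->
  round_sum s i v = Phi (control_move s (tape_at w i) 0).1
    (move_head (control_move s (tape_at w i) 0).2 i) v.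
Proof. by rewrite /round_sum => ->;
  rewrite big_ord_recl big_ord0 addr0 act1. Qed.

Lemma round_sum_reject s i v : (forall j u, Phi Reject j u = 0) ->
  (forall j, (control_move s (tape_at w i) j).1 = Reject) ->
  round_sum s i v = 0.
Proof. by move=> P0 mv; rewrite /round_sum big1 // => j _; rewrite mv P0. Qed.

Lemma round_sum_symbol p q ch k x l q' K v :
  drop k w = x :: l -> next_location q x = Some q' ->
  (forall u, Phi Restart k.+1 u = K * sqnorm u) ->
  let A := symbol_mx p q ch x in
  round_sum (Run p q ch) k.+1 v =
  Phi (Ask p q' (choose_after false q' false ch)) k.+2 (act A v) +
  Phi (Ask p q' (choose_after false q' true ch)) k.+2 (act A v) +
  K * (sqnorm v - 2 * sqnorm (act A v)).
Proof.
move=> E nq PK A; rewrite /round_sum tape_atS E.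
have C := superoperator_complete (symbol_mx_small p q ch x).
have := sum_complete (K := K)
  (G := fun j u => Phi (control_move (Run p q ch) (Sym x) j).1
     (move_head (control_move (Run p q ch) (Sym x) j).2 k.+1) u) v C.
by rewrite /= nq /= => ->.
Qed.

Lemma round_sum_test q ch k K K' v :
  drop k w = [::] -> q = ExpectQuantifier false ->
  (forall u, Phi Restart k.+1 u = K * sqnorm u) ->
  (forall u, Phi Accept k.+1 u = K' * sqnorm u) ->
  (forall u, Phi Reject k.+1 u = 0) ->
  round_sum (Run true q ch) k.+1 v =
  K * (v o0 0 ^+ 2 + v o1 0 ^+ 2) + K' * v o3 0 ^+ 2.
Proof.
move=> E -> PK PA PR; rewrite /round_sum tape_atS E.
pose mv := control_move (Run true (ExpectQuantifier false) ch) RightEnd.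
have := sum_columns (fun j u => Phi (mv j).1 (move_head (mv j).2 k.+1) u)
  (fun h => delta_mx h 0) v.
rewrite /= => ->; rewrite !big_ord_recl big_ord0 /= !PK PA PR !sqnormZ.
have d (i : 'I_4) :
    sqnorm (map_mx ratr (delta_mx i 0 : 'cV[rat]_4) : 'cV[R]_4) = 1.
  rewrite map_delta_mx /sqnorm (bigD1 i) //= big1 => [|j ji].
    by rewrite mxE !eqxx expr1n addr0.
  by rewrite mxE (negPf ji) expr0n.
by rewrite !d; ring.
Qed.

Lemma round_sum_start v :
  round_sum Restart 0 v =
  \sum_(i < 4) Phi (Run false start false) 1 (v i 0 *: map_mx ratr start_col).
Proof. exact: (sum_columns (fun _ u => Phi (Run false start false) 1%N u)). Qed.

End RoundSums.

Lemma potential_game_verifier Phi cost :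
  (forall s i v, 0 <= Phi s i v) ->
  (forall s i a v, Phi s i (a *: v) <= a ^+ 2 * Phi s i v) ->
  (forall p q ch i v u, (0 < i)%N ->
     cost * sqnorm v + Phi (Run p q (choose_after true q u ch)) i v
     <= Phi (Ask p q ch) i v) ->
  (forall s i v, head_ok s i -> s != Accept -> s != Reject -> ~~ is_ask s ->
     cost * sqnorm v + round_sum Phi s i v <= Phi s i v) ->
  potential (V := game_verifier) w Phi head_ok cost.
Proof.
move=> P0 PZ Pc Pr.
split=> [s i v _|s i a v _|s i v u Is _ _|s i Is sa sr sread].
- exact: P0.
- exact: PZ.
- by case: s Is => //= p q ch /andP[iL i0] _; split; [apply/andP|exact: Pc].
- by split=> [j _|v]; [exact: head_ok_read|exact: Pr].
Qed.

Lemma start_col_coords : let u := map_mx ratr start_col : 'cV[R]_4 in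
  [/\ u o0 0 = 4 / 5, u o3 0 = 3 / 5, coords u 0 0 & sqnorm u = 1].
Proof.
rewrite /coords sqnorm4 !mxE /= !rmorph0 !rmorphM !fmorphV !rmorph_nat.
by split; rewrite ?mul0r //; field.
Qed.

Lemma symbols_left_ask p q ch q' ch' k : (k < L)%N ->
  symbols_left (Run p q ch) k.+1 = (symbols_left (Ask p q' ch') k.+2).+1.
Proof. by move=> kL /=; lia. Qed.

Lemma lost_ask p q ch i v u :
  lost (Ask p q ch) i v -> lost (Run p q (choose_after true q u ch)) i v.
Proof.
move=> /lostP[z1 [z2 [c h]]]; apply/lostP; exists z1, z2; split=> // h'.
by apply: h; exists u.
Qed.

(** If the prover could win after either coin, it could win before; so at least one coin preserves a
    lost position. *)
Lemma lost_symbol p q ch k x l q' v :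
  drop k w = x :: l -> next_location q x = Some q' ->
  (lost (Run p q ch) k.+1 v <=
   lost (Ask p q' (choose_after false q' false ch)) k.+2
     (act (symbol_mx p q ch x) v) +
   lost (Ask p q' (choose_after false q' true ch)) k.+2
     (act (symbol_mx p q ch x) v))%N.
Proof.
move=> E nq; set v' := act _ v; case: lostP => // -[z1 [z2 [c h]]].
have c' := coords_symbol p q ch x c.
have [_ E'] := drop_consE E.
have lj j : ~ win_pos (Ask p q' (choose_after false q' j ch)) k.+2
    (current_update x z1) (balance_update p q ch x z1 z2) ->
  lost (Ask p q' (choose_after false q' j ch)) k.+2 v'.
  by move=> ?; apply/lostP; do 2!eexists; split; first exact: c'.
case: (boolP (lost _ _ v')) => // l0; case: (boolP (lost _ _ v')) => // l1;
  case: h.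
rewrite /= E; have win_next j : exists u, win w p q'
   (choose_after true q' u (choose_after false q' j ch)) l
   (current_update x z1) (balance_update p q ch x z1 z2).
  have := E'; rewrite /= => <-; apply: contrapT => /lj.
  by apply/negP; case: j.
by move: win_next; case: p {c' lj l0 l1 v'} => /=; rewrite nq.
Qed.

Lemma lost_end_back q ch k v : drop k w = [::] -> q = ExpectQuantifier false ->
  lost (Run false q ch) k.+1 v -> lost Back k.+1 v.
Proof.
move=> E -> /lostP[z1 [z2 [c h]]]; apply/lostP; exists z1, z2; split=> // h'.
by apply: h; rewrite /= E.
Qed.

(** The balance is a nonzero integer multiple of the first amplitude. *)
Lemma lost_end_test q ch k v : drop k w = [::] -> q = ExpectQuantifier false ->
  lost (Run true q ch) k.+1 v -> v o0 0 ^+ 2 <= v o2 0 ^+ 2.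
Proof.
move=> E -> /lostP[z1 [z2 [[_ ->] h]]]; have z0 : z2 != 0.
  by apply/eqP => z0; apply: h; rewrite /= E.
rewrite exprMn ler_peMl ?sqr_ge0 // -rmorphXn /= ler1z -gtz0_ge1.
by rewrite exprn_even_gt0.
Qed.

Lemma lerB_bool (X c d : R) (b b' : bool) : 0 <= c -> 0 <= d -> (b' -> b) ->
  X - 2 / 5 * (c * d * b%:R) <= X - 2 / 5 * (c * d * b'%:R).
Proof.
move=> c0 d0 bb'; have := mulr_ge0 c0 d0.
by case: b' bb' => [->//|_]; case: b => /=; lra.
Qed.

Lemma potential_accept : ~ knapsack_game w ->
  potential (V := game_verifier) w accept_potential head_ok 0.
Proof.
move=> lose; apply: potential_game_verifier.
- exact: accept_potential_ge0.
- exact: accept_potentialZ.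
- move=> p q ch i v u _; rewrite mul0r add0r /accept_potential /inv_pow /=.
  apply: lerB_bool; rewrite ?sqr_ge0 ?exprn_ge0 //; exact: lost_ask.
move=> s i v /andP[iL i0] sA sR sask; rewrite mul0r add0r.
case: i iL i0 => [|k] iL i0.
  case: s i0 sA sR sask => //= _ _ _ _.
  - rewrite round_sum_start; have [u0 u3 uc u1] := start_col_coords.
    set u := map_mx _ _ in u0 u3 uc u1 *.
    have lu : lost (Run false start false) 1 u.
      apply/lostP; exists 0, 0; split=> //;
        by rewrite /win_pos drop0 => /win_knapsack_game.
    have Pu : accept_potential (Run false start false) 1 u <= 2 / 5.
      rewrite /accept_potential u0 u3 u1 lu /inv_pow.
      set n := symbols_left _ _; rewrite /=.
      (* The gain [3 / 5 * (3 / 5) ^+ 2] is 27/125, the loss [2 / 5 * (4 / 5) ^+ 2] is 32/125. *)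
      have : (32^-1 : R) ^+ n <= 16^-1 ^+ n by rewrite lerXn2r ?nnegrE //; lra.
      have : 0 <= (16^-1 : R) ^+ n by rewrite exprn_ge0.
      by lra.
    rewrite /sqnorm mulr_sumr; apply: ler_sum => i _.
    apply: le_trans (accept_potentialZ _ _ _ _) _.
    by rewrite mulrC ler_wpM2r ?sqr_ge0.
  - rewrite round_sum1 //= /inv_pow /= subn1 addn0.
    apply: lerB_bool; rewrite ?sqr_ge0 ?exprn_ge0 //.
    move=> /lostP[z1 [z2 [c h]]]; apply/lostP; exists z1, z2; split=> //.
    by rewrite /win_pos drop0.
case E: (drop k w) => [|x l].
  have kL : k = L by have := drop_nilE E; lia.
  case: s i0 sA sR sask => [| | | |p q ch|p q ch] //= _ _ _ _.
  - by rewrite round_sum1 /= tape_atS E.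
  - by rewrite round_sum1 /= tape_atS E.
  have [qe|qn] := eqVneq q (ExpectQuantifier false); last first.
    rewrite round_sum_reject //;
      first exact: (accept_potential_ge0 (Run p q ch)).
    by move=> j; rewrite tape_atS E /= (negPf qn).
  case: p => /=.
    rewrite (round_sum_test (K := 2 / 5) (K' := 1) ch v E qe) //=;
      last by move=> u; rewrite mul1r.
    rewrite /inv_pow /= addn0 subSS -kL subnn !expr0 !mul1r sqnorm4.
    (* In a lost position, the weight of rejection pays for the subtracted term. *)
    case: (boolP (lost _ _ _)) => [/(lost_end_test E qe)|_] /=.
      by have := sqr_ge0 (v o0 0); lra.
    by have := sqr_ge0 (v o2 0); lra.
  rewrite round_sum1 /= tape_atS E /= ?qe //= /inv_pow /= subSS -kL subnn add0n.
  apply: lerB_bool; rewrite ?sqr_ge0 ?exprn_ge0 //.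
  by move=> lr; apply: lost_end_back lr.
have [kL _] := drop_consE E.
case: s i0 sA sR sask => [| | | |p q ch|p q ch] //= _ _ _ _.
- by rewrite round_sum1 /= tape_atS E.
- by rewrite round_sum1 /= tape_atS E.
case nq: (next_location q x) => [q'|]; last first.
  rewrite round_sum_reject //; first exact: (accept_potential_ge0 (Run p q ch)).
  by move=> j; rewrite tape_atS E /= nq.
rewrite (round_sum_symbol (K := 2 / 5) _ _ _ E nq) //.
have := lost_symbol p ch v E nq; rewrite -(ler_nat R) natrD /=.
set l0 := (lost (Ask _ _ (choose_after _ _ false _)) _ _)%:R.
set l1 := (lost (Ask _ _ (choose_after _ _ true _)) _ _)%:R => ll.
rewrite /accept_potential /inv_pow (symbols_left_ask p q ch q' ch kL).
rewrite -/l0 -/l1 !act_symbol0 !act_symbol3 /=; set n := (_ + _)%N.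
rewrite !exprS.
(* The terms in [sqnorm] and in the fourth amplitude balance exactly; the remaining one is [ll]
   multiplied by this quantity. *)
have : 0 <= (16^-1 : R) ^+ n * v o0 0 ^+ 2.
  by rewrite mulr_ge0 ?sqr_ge0 ?exprn_ge0.
by move=> /ler_wpM2l/(_ _ _ ll); lra.
Qed.

(** Steps to the end of the round if it does not fail earlier: two per symbol, one to read and one
    to ask. In the first pass, [3 * L + 3] more are the way back and the second pass. *)
Definition steps_left s i : nat :=
  match s with
  | Run p _ _ => 2 * (L.+1 - i) + 1 + (if p then 0 else 3 * L + 3)
  | Ask p _ _ => 2 * (L.+1 - i) + 2 + (if p then 0 else 3 * L + 3)
  | Back => i + (2 * L + 2)
  | _ => 0
  end.

(* [t0] bounds the expected time from a restart at the left end, and [t1] that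
   from the failure of a round. *)
Section Time.
Context (t0 t1 : nat).

(** The factor of [t1] bounds the weight of the runs that will restart: the total weight less that
    of acceptance at the end of the round. *)
Definition time_potential s i v : R :=
  match s with
  | Accept | Reject => 0
  | Restart => (i + t0)%:R * sqnorm v
  | _ => (steps_left s i)%:R * sqnorm v +
         t1%:R * (sqnorm v - inv_pow 32 s i * v o3 0 ^+ 2)
  end.

Lemma pending_ge0 s i v : 0 <= sqnorm v - inv_pow 32 s i * v o3 0 ^+ 2.
Proof.
have [_ h3] := sqnorm4_ge v; rewrite subr_ge0.
have := @inv_pow_mul_le 32 s i (v o3 0 ^+ 2) (sqnorm v).
by rewrite sqr_ge0 h3 => /(_ _ isT)/andP[] //; lra.
Qed.

Lemma time_potential_ge0 s i v : 0 <= time_potential s i v.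
Proof.
have := pending_ge0 s i v; have := sqnorm_ge0 v.
by case: s => //= *; rewrite ?addr_ge0 // mulr_ge0.
Qed.

Lemma time_potentialZ s i a v :
  time_potential s i (a *: v) <= a ^+ 2 * time_potential s i v.
Proof. by case: s => //= *; rewrite ?sqnormZ ?mxE; lra. Qed.

(** The first hypothesis covers the way of at most [L.+1] cells back to the left end. In the second,
    [5 * L + 5] is the length of a full round, and the factor of [t1] is the value of the pending
    weight at its start. *)
Lemma potential_time : (L.+1 + t0 <= t1)%N ->
  (5 * L + 5)%:R + t1%:R * (1 - (32^-1) ^+ (L + L) * (9 / 25)) <= t0%:R :> R ->
  potential (V := game_verifier) w time_potential head_ok 1.
Proof.
move=> t01 ht; apply: potential_game_verifier.
- exact: time_potential_ge0.
- exact: time_potentialZ.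
- move=> p q ch i v u _; rewrite mul1r /time_potential /inv_pow /=.
  by rewrite !natrD; lra.
move=> s i v /andP[iL i0] sA sR sask; rewrite mul1r.
have v0 := sqnorm_ge0 v.
have reject_ok p q ch k :
    (forall j, (control_move (Run p q ch) (tape_at w k) j).1 = Reject) ->
    sqnorm v + round_sum time_potential (Run p q ch) k v <=
    time_potential (Run p q ch) k v.
  move=> mv; rewrite round_sum_reject //= !natrD addr0.
  have := mulr_ge0 (ler0n R t1) (pending_ge0 (Run p q ch) k v).
  have : 0 <= (2 * (L.+1 - k))%:R * sqnorm v by rewrite mulr_ge0.
  have : 0 <= (if p then 0 else 3 * L + 3)%N%:R * sqnorm v by rewrite mulr_ge0.
  by lra.
case: i iL i0 => [|k] iL i0.
  case: s i0 sA sR sask => //= _ _ _ _.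
  - rewrite round_sum_start; have [u0 u3 uc u1] := start_col_coords.
    set u := map_mx _ _ in u0 u3 uc u1 *.
    have Pu : 1 + time_potential (Run false start false) 1 u <= t0%:R.
      rewrite /time_potential u3 u1 /inv_pow /= !mulr1 subn1 /=.
      rewrite (_ : (3 / 5) ^+ 2 = 9 / 25); last by field.
      by apply: le_trans ht; rewrite addrA -natr1 !(natrD, natrM); lra.
    rewrite add0n -[X in X + _]mul1r; apply: le_trans (ler_wpM2r v0 Pu).
    rewrite mulrDl lerD2l /sqnorm mulr_sumr; apply: ler_sum => i _.
    by apply: le_trans (time_potentialZ _ _ _ _) _; rewrite mulrC.
  - rewrite round_sum1 //= /inv_pow /= subn1 /= !addn0 add0n.
    by rewrite -natr1 !(natrD, natrM); lra.
have Back_ok t : tape_at w k.+1 = t -> t <> LeftEnd ->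
  sqnorm v + round_sum time_potential Back k.+1 v <=
  time_potential Back k.+1 v.
  move=> E nt; rewrite round_sum1 ?E; last by case: t nt {E}.
  by case: t nt {E} => //= [x|] _; rewrite -natr1 !natrD; lra.
have Restart_ok t : tape_at w k.+1 = t -> t <> LeftEnd ->
  sqnorm v + round_sum time_potential Restart k.+1 v <=
  time_potential Restart k.+1 v.
  move=> E nt; rewrite round_sum1 ?E; last by case: t nt {E}.
  by case: t nt {E} => //= [x|] _; rewrite -natr1 !natrD; lra.
have fail_le : (k.+1 + t0)%:R <= t1%:R :> R.
  by rewrite ler_nat; lia.
case E: (drop k w) => [|x l].
  have kL : k = L by have := drop_nilE E; lia.
  case: s i0 sA sR sask => [| | | |p q ch|p q ch] // _ _ _ _.
  - by apply: Restart_ok; rewrite ?tape_atS ?E.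
  - by apply: Back_ok; rewrite ?tape_atS ?E.
  have [qe|qn] := eqVneq q (ExpectQuantifier false); last first.
    by apply: reject_ok => j; rewrite tape_atS E /= (negPf qn).
  case: p => /=.
    rewrite (round_sum_test (K := (k.+1 + t0)%:R) (K' := 0) ch v E qe) //=;
      last by move=> u; rewrite mul0r.
    rewrite /inv_pow /= addn0 subSS -kL subnn !expr0 !mul1r mul0r addr0.
    move: fail_le v0; set K := (_ + _)%:R; set K' := t1%:R => fail_le v0.
    have : 0 <= K by []. rewrite sqnorm4.
    have := sqr_ge0 (v o0 0); have := sqr_ge0 (v o1 0);
      have := sqr_ge0 (v o2 0).
    by nra.
  rewrite round_sum1 /= tape_atS E /= ?qe //= /inv_pow /= subSS -kL subnn add0n.
  by rewrite -natr1 !(natrD, natrM); lra.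
have [kL _] := drop_consE E.
case: s i0 sA sR sask => [| | | |p q ch|p q ch] // _ _ _ _.
- by apply: Restart_ok; rewrite ?tape_atS ?E.
- by apply: Back_ok; rewrite ?tape_atS ?E.
case nq: (next_location q x) => [q'|]; last first.
  by apply: reject_ok => j; rewrite tape_atS E /= nq.
rewrite (round_sum_symbol (K := (k.+1 + t0)%:R) _ _ _ E nq) //.
have := act_symbol_contracts p q ch x v.
rewrite /time_potential /inv_pow (symbols_left_ask p q ch q' ch kL).
rewrite !act_symbol3 [32^-1 ^+ _.+1]exprS; set a := _ ^+ symbols_left _ _;
  rewrite /=.
set dn := (2 * (L.+1 - k.+2) + 2 + (if p then 0 else 3 * L + 3))%N.
have -> : (2 * (L.+1 - k.+1) + 1 + (if p then 0 else 3 * L + 3) = dn.+1)%N.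
  by rewrite /dn; lia.
rewrite -[dn.+1%:R]natr1; set d := dn%:R.
have d0 : 0 <= d by [].
move: fail_le v0 (sqnorm_ge0 (act (symbol_mx p q ch x) v)).
set K := (_ + _)%:R; set K' := t1%:R; set y := sqnorm (act _ _).
set z := sqnorm v => fail_le v0 y0 yz.
(* [z - 2 * y] is the weight of the outcomes that restart, each worth [K] instead of the [K']
   already set aside. *)
have : 0 <= (K' - K) * (z - 2 * y) by rewrite mulr_ge0 ?subr_ge0.
have : 0 <= d * (z - 2 * y) by rewrite mulr_ge0 ?subr_ge0.
by lra.
Qed.

End Time.

(** [2 ^ (10 * L)] is [32 ^ (2 * L)], 3 exceeds 25/9, and [6 * L + 7] exceeds the length of a round
    together with the way back. *)
Definition restart_time : nat := 3 * (6 * L + 7) * 2 ^ (10 * L).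

(* From a restart, a round halts with probability at least [9 / 25 * 2^-10L]. *)
Lemma restart_time_start :
  (5 * L + 5)%:R +
  (L.+1 + restart_time)%:R * (1 - (32^-1) ^+ (L + L) * (9 / 25))
  <= restart_time%:R :> R.
Proof.
have -> : (32^-1 : R) ^+ (L + L) = 2^-1 ^+ (10 * L).
  have -> : (32^-1 : R) = 2^-1 ^+ 5 by rewrite !exprS expr0; field.
  by rewrite -exprM; congr (_ ^+ _); lia.
have : (2^-1 : R) ^+ (10 * L) * restart_time%:R = (3 * (6 * L + 7))%:R.
  rewrite /restart_time natrM natrX exprVn mulrCA.
  by rewrite mulVf ?mulr1 ?expf_neq0.
have : 0 <= (2^-1 : R) ^+ (10 * L) by rewrite exprn_ge0.
have : (2^-1 : R) ^+ (10 * L) <= 1 by apply: exprn_ile1; lra.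
move: (restart_time) => t; set x := _ ^+ _;
  rewrite -natr1 !(natrD, natrM) -natr1.
have : 0 <= L%:R :> R by [].
by nra.
Qed.

Definition prover_good s i v : Prop :=
  head_ok s i /\
  match s with
  | Reject => False
  | Accept | Restart => True
  | _ => exists z1 z2, coords v z1 z2 /\ win_pos s i z1 z2
  end.

Lemma prover_good_read s i v j a : knapsack_game w ->
  prover_good s i v -> s != Accept -> ~~ is_ask s ->
  (j < size (control_ops s (tape_at w i)))%N ->
  sqnorm (act (nth 0 (control_ops s (tape_at w i)) j) v) != 0 ->
  prover_good (control_move s (tape_at w i) j).1
    (move_head (control_move s (tape_at w i) j).2 i)
    (a *: act (nth 0 (control_ops s (tape_at w i)) j) v).
Proof.
move=> gw [hs gs] sA sask jE nz; split; first exact: head_ok_read.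
case: i hs gs jE nz => [|k] /andP[iL i0].
  case: s sA sask i0 => //= _ _ _.
  - move=> _; rewrite size_column_ops => j4 _.
    exists 0, 0; split; last by rewrite /win_pos drop0; exact/win_knapsack_game.
    rewrite (act_column _ (Ordinal j4)); have [_ _ c _] := start_col_coords.
    by do 2!apply: coordsZ.
  - move=> [z1 [z2 [c h]]]; rewrite ltnS leqn0 => /eqP-> _; rewrite act1.
    by exists z1, z2; split; [exact: coordsZ|rewrite /win_pos drop0].
rewrite tape_atS; case D: (drop k w) => [|x l].
  case: s sA sask i0 => [| | | |p q ch|p q ch] //= _ _ _.
    move=> [z1 [z2 [c h]]]; rewrite ltnS leqn0 => /eqP-> _; rewrite act1.
    by exists z1, z2; split; first exact: coordsZ.
  case: p => -[z1 [z2 [c]]]; rewrite /= D => -[-> h] /=.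
    rewrite size_column_ops => j4; rewrite (act_column _ (Ordinal j4)).
    case: j j4 => [|[|[|[|//]]]] j4 //=.
    have -> : Ordinal j4 = o2 by exact: val_inj.
    (* The balance is 0, so the rejecting outcome has probability 0, against [nz]. *)
    have [_ ->] := c; rewrite h mul0r scale0r /sqnorm big1 ?eqxx // => ? _.
    by rewrite mxE expr0n.
  rewrite ltnS leqn0 => /eqP-> _; rewrite act1.
  by exists z1, z2; split; first exact: coordsZ.
have [_ Dl] := drop_consE D.
case: s sA sask i0 => [| | | |p q ch|p q ch] //= _ _ _.
  move=> [z1 [z2 [c h]]]; rewrite ltnS leqn0 => /eqP-> _; rewrite act1.
  by exists z1, z2; split; first exact: coordsZ.
move=> [z1 [z2 [c h]]].
(* Both passes unfold in the same way; in particular a winning position excludes a syntax error. *)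
have {h} : (if next_location q x is Some q' then
    forall j, exists u,
      win w p q' (choose_after true q' u (choose_after false q' j ch)) l
      (current_update x z1) (balance_update p q ch x z1 z2)
  else False) : Prop by move: h; rewrite /win_pos /= D; case: (p).
case: next_location => [q'|//] h.
have cj b : exists z1 z2, coords (a *: act (symbol_mx p q ch x) v) z1 z2 /\
    win_pos (Ask p q' (choose_after false q' b ch)) k.+2 z1 z2.
  exists (current_update x z1), (balance_update p q ch x z1 z2); split.
    exact/coordsZ/coords_symbol.
  by rewrite /win_pos Dl.
by case: j => [|[|j]] //= _ _; exact: cj.
Qed.

Lemma prover_good_ask s i v : prover_good s i v -> s != Accept -> is_ask s ->
  exists u, prover_good (control_comm s u) i v.
Proof.
case: s => // p q ch [/andP[iL i0]] [z1 [z2 [c [u h]]]] _ _.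
exists u; split; first by apply/andP.
by exists z1, z2.
Qed.

End Potentials.

Theorem theorem1 (R : realType) :
  exists (V : verifier ksym) (P : prover R V) (eps : R),
    [/\ 0 <= eps < 2^-1,
        verifies P knapsack_game eps,
        perfectly_complete P knapsack_game
      & exponential_expected_time R V].
Proof.
pose V := game_verifier.
pose P : prover R V := honest_prover (fun w => prover_good w : state V -> _).
have init1 : sqnorm (delta_mx ord0 0 : 'cV[R]_4) = 1 := @sqnorm_init R _ V.
have ok0 w : head_ok w Restart 0 by [].
have running (P' : prover R V) w N :
    \sum_(t < N) (1 - prob_after P' w halted t) <= (restart_time w)%:R.
  have pot := potential_time (leqnn _) (@restart_time_start R w).
  apply: le_trans (sum_running_le P' N pot (ok0 w)) _.
  by rewrite /= init1 mulr1.
have complete_P w : knapsack_game w -> accept_prob P w = 1.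
  move=> gw; apply: (accept_prob1 (running P w)) => t.
  apply: honest_prover_wins.
  - by split.
  - by move=> s i v [_]; case: s.
  - by move=> s i v g sA sc; apply: prover_good_ask.
  - by move=> s i v j g sA sc /= jE nz a; apply: prover_good_read.
(* The error is the value of a restart in [accept_potential]. *)
exists V, P, (2 / 5); split.
- by apply/andP; split; lra.
- split=> [w gw|w gw P']; first by rewrite complete_P //; lra.
  apply: (reject_prob_ge (running P' w)) => t.
  have pot := potential_accept (R := R) gw.
  have := prob_after_le (Q := accepting) P' t pot _ (ok0 w).
  rewrite /= init1 mulr1; apply.
  by move=> s i v h _ v1 /eqP /= ->; rewrite /= v1.
- exact: complete_P.
(* Since [n < 2 ^ n], the factor [3 * (6 * n + 7)] is at most [21 * 2 ^ n]. *)
exists 21%N, 11%N => P' w; apply: expected_time_le => N.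
apply: le_trans (running P' w N) _; rewrite ler_nat /restart_time.
have := ltn_expl (size w) (ltnSn 1); move: (size w) => n.
rewrite (_ : 11 * n = n + 10 * n)%N; last by lia.
by rewrite expnD; nia.
Qed.
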